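(* The following problem is decidable: given regular languages $S,T\subseteq(\Sigma\cup\Gamma)^*$ of finite shiftlag, where $T=U\Sigma^*\Gamma^*$ for a regular $(\Sigma\Gamma)^*$-prefix closed set $U\subseteq(\Sigma\Gamma)^*$, decide whether $\llbracket S\rrbracket\in\textsc{Rel}(T)$.
   Context: $\Sigma,\Gamma$ are disjoint finite alphabets. A set $U\subseteq(\Sigma\Gamma)^*$ is $(\Sigma\Gamma)^*$-prefix closed if $uab\in U$ implies $u\in U$ for all $u\in(\Sigma\Gamma)^*$, $a\in\Sigma$, $b\in\Gamma$. For $w\in(\Sigma\cup\Gamma)^*$, $\llbracket w\rrbracket=(\pi_{\mathtt i}(w),\pi_{\mathtt o}(w))$ where $\pi_{\mathtt i}$ (resp. $\pi_{\mathtt o}$) deletes all letters of $\Gamma$ (resp. $\Sigma$), and $\llbracket L\rrbracket=\{\llbracket w\rrbracket:w\in L\}$. $\textsc{Rel}(T)=\{\llbracket T'\rrbracket: T'\subseteq T,\ T'\text{ regular}\}$. A position $i$ of $w$ is $\geq k$-lagged if the absolute difference between the numbers of $\Sigma$-letters and $\Gamma$-letters in $w[1..i]$ is at least $k$. A shift of $w$ is a position $i\in\{1,\dots,|w|-1\}$ with exactly one of $w[i],w[i+1]$ in $\Sigma$; shifts $i<j$ are consecutive if no shift lies strictly between them. $\mathit{shiftlag}(w)$ is the maximal $n$ such that $w$ contains $n$ consecutive shifts all $\geq n$-lagged; a language has finite shiftlag if the supremum over its words is finite. *)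

(* Defs.v *)
From mathcomp Require Import all_boot.
Set Implicit Arguments. Unset Strict Implicit. Unset Printing Implicit Defensive.

(* Model of computation: partial mu-recursive functions on nat.        *)
(* (Decidability must be stated w.r.t. an explicit model: in Rocq with  *)
(*  classical axioms, "exists f : _ -> bool" would be trivial.)         *)
Inductive prog : Type :=
| PZero
| PSucc
| PProj of nat
| PComp of prog & seq prog
| PRec of prog & prog
| PMu of prog.

Inductive eval : prog -> seq nat -> nat -> Prop :=
| evZero xs : eval PZero xs 0
| evSucc xs : eval PSucc xs (nth 0 xs 0).+1
| evProj i xs : eval (PProj i) xs (nth 0 xs i)
| evComp f gs xs ys y : evals gs xs ys -> eval f ys y -> eval (PComp f gs) xs y
| evRec0 f g xs y : eval f xs y -> eval (PRec f g) (0 :: xs) y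
| evRecS f g n xs y z :
    eval (PRec f g) (n :: xs) y -> eval g (n :: y :: xs) z ->
    eval (PRec f g) (n.+1 :: xs) z
| evMu f xs n :
    (forall m, m < n -> exists k, eval f (m :: xs) k.+1) ->
    eval f (n :: xs) 0 -> eval (PMu f) xs n
with evals : seq prog -> seq nat -> seq nat -> Prop :=
| evsNil xs : evals [::] xs [::]
| evsCons g gs xs y ys : eval g xs y -> evals gs xs ys -> evals (g :: gs) xs (y :: ys).

Definition cpair (a b : nat) : nat := (a + b) * (a + b).+1 %/ 2 + b.
Fixpoint code_seq (s : seq nat) : nat :=
  if s is x :: s' then (cpair x (code_seq s')).+1 else 0.

Section Alph.
Variables ns ng : nat.

Definition inSigma (a : nat) : bool := a < ns.
Definition inGamma (a : nat) : bool := (ns <= a) && (a < ns + ng).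
Definition is_word (w : seq nat) : bool := all (fun a => a < ns + ng) w.

Definition lang := seq nat -> Prop.

(* Deterministic finite automata: states are naturals, start state 0,  *)
(* transition q --a--> nth 0 (nth [::] delta q) a, accepting states final. *)
Record dfa := DFA { delta : seq (seq nat); final : seq nat }.
Definition run (A : dfa) (w : seq nat) : nat :=
  foldl (fun q a => nth 0 (nth [::] (delta A) q) a) 0 w.
Definition dfa_lang (A : dfa) : lang := fun w => is_word w && (run A w \in final A).
Definition code_dfa (A : dfa) : nat :=
  code_seq [:: code_seq (map code_seq (delta A)); code_seq (final A)].

Definition regular (L : lang) : Prop := exists A : dfa, forall w, L w <-> dfa_lang A w.

Definition sem_word (w : seq nat) : seq nat * seq nat :=
  (filter inSigma w, filter inGamma w).
Definition sem (L : lang) : seq nat * seq nat -> Prop :=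
  fun p => exists w, L w /\ sem_word w = p.

Definition in_Rel (S T : lang) : Prop :=
  exists T' : lang, regular T' /\ (forall w, T' w -> T w) /\
    (forall p, sem T' p <-> sem S p).

(* Shifts and lag (positions are 1-indexed: w[i] = nth 0 w i.-1,       *)
(* w[1..i] = take i w).                                                *)
Definition lag (w : seq nat) (i : nat) : nat :=
  let s := count inSigma (take i w) in
  let g := count inGamma (take i w) in (s - g) + (g - s).
Definition is_shift (w : seq nat) (i : nat) : bool :=
  (1 <= i) && (i <= (size w).-1) &&
  (inSigma (nth 0 w i.-1) != inSigma (nth 0 w i)).
Definition shifts (w : seq nat) : seq nat := filter (is_shift w) (iota 1 (size w).-1).

Definition has_lagged_shift_block (w : seq nat) (n : nat) : Prop :=
  exists k, k + n <= size (shifts w) /\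
    forall j, j < n -> n <= lag w (nth 0 (shifts w) (k + j)).

Definition shiftlag_le (w : seq nat) (B : nat) : Prop :=
  forall n, has_lagged_shift_block w n -> n <= B.
Definition finite_shiftlag (L : lang) : Prop :=
  exists B, forall w, L w -> shiftlag_le w B.

Definition in_SG (w : seq nat) : bool :=
  ~~ odd (size w) &&
  all (fun i => if ~~ odd i then inSigma (nth 0 w i) else inGamma (nth 0 w i))
      (iota 0 (size w)).
Definition SG_prefix_closed (U : lang) : Prop :=
  forall u a b, in_SG u -> inSigma a -> inGamma b -> U (u ++ [:: a; b]) -> U u.

Definition U_SigStar_GamStar (U : lang) : lang :=
  fun w => exists u x y, w = u ++ x ++ y /\ U u /\ all inSigma x /\ all inGamma y.

Definition promise (AS AT : dfa) : Prop :=
  finite_shiftlag (dfa_lang AS) /\ finite_shiftlag (dfa_lang AT) /\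
  exists U : lang, regular U /\ (forall u, U u -> in_SG u) /\ SG_prefix_closed U /\
    (forall w, dfa_lang AT w <-> U_SigStar_GamStar U w).

End Alph.

Definition code_input (AS AT : dfa) : nat := code_seq [:: code_dfa AS; code_dfa AT].

(* Main.v *)
(* Read a word as a number in base [c = |Sigma| + |Gamma| + 2], first letter in the lowest
   digit. A predicate on tuples of numbers has index at most [n] if reading low-order digits
   leaves at most [n] residual predicates; a quantifier over such a predicate can be bounded
   by a computable number (pumping), so first-order statements about it are decided by bounded
   search, once the index is bounded computably.

   If [S] has finite shiftlag, its relation has bounded index: when a word of [S] has used up
   the first [j] letters of one component while the other lags behind, the latter catches up
   within boundedly many blocks. Otherwise the large lag would need a loop with nonzero drift,
   the many blocks a loop using both alphabets, and iterating both loops would make the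
   shiftlag infinite.

   A word of [T = U Sigma^* Gamma^*] fixes a synchronous prefix in [U]. Since [U] is prefix
   closed, each pair [(x, y)] has a longest such prefix, of length [T0] say; let [E t] be the
   part of [[S]] with [t = c ^ T0]. Then [[S]] is in Rel(T) iff for every [t] the relation
   [E t] has finitely many left sections, i.e. is recognizable. If so, there are finitely many
   residuals of [E] after a prefix [z] in [U], each is a finite union of products [X * Y] of
   regular languages, and the words [z X Y] form the required [T']. Conversely, given a
   regular [T'], a left section of [E t] is determined by the first [T0 + 1] letters of [x] and
   by the action of the rest of [x] on the states of [T']. *)
Require Import Defs.
From mathcomp Require Import all_boot.
From mathcomp Require Import boolp zify.
Set Implicit Arguments. Unset Strict Implicit. Unset Printing Implicit Defensive.

(** * Computable functions *)

Definition computable k (f : seq nat -> nat) : Prop :=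
  exists p, forall xs, size xs = k -> eval p xs (f xs).

Fixpoint computable_all k (fs : seq (seq nat -> nat)) : Prop :=
  if fs is f :: fs' then computable k f /\ computable_all k fs' else True.

Lemma cf_ext k f g : (forall xs, size xs = k -> f xs = g xs) -> computable k f -> computable k g.
Proof. by move=> fg [p Hp]; exists p => xs sz; rewrite -fg //; apply: Hp. Qed.

Lemma computable_all_evals k fs : computable_all k fs ->
  exists ps, forall xs, size xs = k -> evals ps xs [seq f xs | f <- fs].
Proof.
elim: fs => [_|f fs IH [[p Hp] /IH[ps Hps]]] /=.
  by exists [::] => xs _; constructor.
by exists (p :: ps) => xs sz; constructor; [apply: Hp | apply: Hps].
Qed.

Lemma cf_comp n k g fs : computable n g -> size fs = n -> computable_all k fs ->
  computable k (fun s => g [seq f s | f <- fs]).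
Proof.
move=> [p Hp] szf /computable_all_evals[ps Hps]; exists (PComp p ps) => xs sz.
by apply: evComp (Hps _ sz) _; apply: Hp; rewrite size_map.
Qed.

Lemma cf_nth k i : computable k (fun s => nth 0 s i).
Proof. by exists (PProj i) => xs _; constructor. Qed.

Lemma cf_leaf k f i : (forall s, f s = nth 0 s i) -> computable k f.
Proof. by move=> fE; apply: cf_ext (cf_nth k i) => s _. Qed.

Lemma cf_succ k f : computable k f -> computable k (fun s => (f s).+1).
Proof.
move=> Hf; apply: (@cf_comp 1 k (fun s => (nth 0 s 0).+1) [:: f]) => //.
by exists PSucc => xs _; constructor.
Qed.

Lemma cf_const k n : computable k (fun=> n).
Proof. by elim: n => [|n /cf_succ//]; exists PZero => xs _; constructor. Qed.

Definition projs k : seq (seq nat -> nat) := [seq (fun s => nth 0 s i) | i <- iota 0 k].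

Lemma computable_projs k : computable_all k (projs k).
Proof.
rewrite /projs; elim: (iota 0 k) => //= i l IH; split=> //; exact: cf_nth.
Qed.

Lemma map_projs k s : size s = k -> [seq f s | f <- projs k] = s.
Proof. by move=> <-; rewrite -map_comp; apply: mkseq_nth. Qed.

(** The step function takes counter and accumulator before the parameters, in the order of [PRec].
    Composing with [h] and the projections lets the number of rounds depend on the parameters. *)
Lemma cf_rec k f h (G : nat -> nat -> seq nat -> nat) :
  computable k f -> computable k.+2 (fun s => G (head 0 s) (head 0 (behead s)) (behead (behead s))) ->
  computable k h -> computable k (fun s => iteri (h s) (fun n y => G n y s) (f s)).
Proof.
move=> [p Hp] [q Hq] Hh.
have cR : computable k.+1 (fun s => iteri (head 0 s) (fun n y => G n y (behead s)) (f (behead s))).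
  exists (PRec p q) => -[|n s] //= [sz].
  elim: n => [|n IH] /=; first by constructor; apply: Hp.
  by apply: evRecS IH _; apply: (Hq [:: n, _ & s]); rewrite /= sz.
apply: cf_ext (cf_comp cR (fs := h :: projs k) _ _) => /= [s sz||].
- by rewrite map_projs.
- by rewrite size_map size_iota.
- by split=> //; apply: computable_projs.
Qed.

Ltac leaf := eapply cf_leaf; intros ?; rewrite -?nth0 ?nth_behead; reflexivity.

(** Keeps parameters computable when a counter is put in front of the arguments, as recursions and
    bounded searches do. *)
Lemma cf_weak k f : computable k f -> computable k.+1 (fun s => f (behead s)).
Proof.
move=> Hf.
apply: cf_ext (cf_comp Hf (fs := [seq (fun s => nth 0 s i) | i <- iota 1 k]) _ _).
- move=> [|x s] //= [sz]; congr f; rewrite -map_comp (iotaDl 1 0) -map_comp.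
  by apply/esym/(eq_from_nth (x0 := 0)) => [|i Hi];
    rewrite ?size_map ?size_iota // (nth_map 0) ?size_iota -?sz // nth_iota //=.
- by rewrite size_map size_iota.
- by elim: (iota 1 k) => //= i l IH; split=> //; apply: cf_nth.
Qed.

Lemma cf_weak2 k f : computable k f -> computable k.+2 (fun s => f (behead (behead s))).
Proof. by move=> /cf_weak/cf_weak. Qed.

Lemma cf_add k f g : computable k f -> computable k g -> computable k (fun s => f s + g s).
Proof.
move=> Hf Hg; apply: (@cf_ext _ (fun s => iteri (f s) (fun n y => y.+1) (g s))).
  by move=> s _; elim: (f s) => //= n ->.
by apply: cf_rec => //; apply: cf_succ; leaf.
Qed.

Lemma cf_mul k f g : computable k f -> computable k g -> computable k (fun s => f s * g s).
Proof.
move=> Hf Hg; apply: (@cf_ext _ (fun s => iteri (f s) (fun n y => g s + y) 0)).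
  by move=> s _; elim: (f s) => //= n ->.
apply: cf_rec => //; first exact: cf_const.
by apply: cf_add; [exact: cf_weak2 | leaf].
Qed.

Lemma cf_exp k f g : computable k f -> computable k g -> computable k (fun s => f s ^ g s).
Proof.
move=> Hf Hg; apply: (@cf_ext _ (fun s => iteri (g s) (fun n y => f s * y) 1)).
  by move=> s _; elim: (g s) => //= n ->; rewrite expnS.
apply: cf_rec => //; first exact: cf_const.
by apply: cf_mul; [exact: cf_weak2 | leaf].
Qed.

Lemma cf_sub k f g : computable k f -> computable k g -> computable k (fun s => f s - g s).
Proof.
move=> Hf Hg.
(* The predecessor is the recursion that returns the counter of its last round. *)
have cpred h : computable k.+2 h -> computable k.+2 (fun s => (h s).-1).
  move=> Hh; apply: (@cf_ext _ (fun s => iteri (h s) (fun n y => n) 0)).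
    by move=> s _; case: (h s).
  by apply: cf_rec => //; [exact: cf_const | leaf].
apply: (@cf_ext _ (fun s => iteri (g s) (fun n y => y.-1) (f s))).
  by move=> s _; elim: (g s) => [|n /= ->]; rewrite ?subn0 ?subnS.
by apply: cf_rec => //; apply: cpred; leaf.
Qed.

Definition computableb k (P : seq nat -> bool) : Prop := computable k (fun s => P s : nat).

Lemma cp_not k P : computableb k P -> computableb k (fun s => ~~ P s).
Proof.
move=> HP; apply: (@cf_ext _ (fun s => 1 - P s)); first by move=> s _; case: (P s).
by apply: cf_sub HP; apply: cf_const.
Qed.

Lemma cf_if k P f g : computableb k P -> computable k f -> computable k g -> computable k (fun s => if P s then f s else g s).
Proof.
move=> HP Hf Hg.
apply: (@cf_ext _ (fun s => P s * f s + ~~ P s * g s)).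
  by move=> s _; case: (P s); rewrite ?mul0n ?mul1n ?addn0.
apply: cf_add; apply: cf_mul => //; exact: cp_not.
Qed.

Lemma cp_and k P Q : computableb k P -> computableb k Q -> computableb k (fun s => P s && Q s).
Proof.
move=> HP HQ; apply: (@cf_ext _ (fun s => P s * Q s)); last exact: cf_mul.
by move=> s _; case: (P s); case: (Q s).
Qed.

Lemma cp_or k P Q : computableb k P -> computableb k Q -> computableb k (fun s => P s || Q s).
Proof.
move=> HP HQ; apply: (@cf_ext _ (fun s => ~~ (~~ P s && ~~ Q s))).
  by move=> s _; case: (P s); case: (Q s).
by apply: cp_not; apply: cp_and; apply: cp_not.
Qed.

Lemma cp_leq k f g : computable k f -> computable k g -> computableb k (fun s => f s <= g s).
Proof.
move=> Hf Hg; apply: (@cf_ext _ (fun s => 1 - (f s - g s))).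
  by move=> s _; rewrite /leq; case: (f s - g s) => //= n; rewrite subSS sub0n.
by apply: cf_sub (cf_sub Hf Hg); apply: cf_const.
Qed.

Lemma cp_eq k f g : computable k f -> computable k g -> computableb k (fun s => f s == g s).
Proof.
move=> Hf Hg; apply: (@cf_ext _ (fun s => (f s <= g s) && (g s <= f s))).
  by move=> s _; rewrite eqn_leq.
by apply: cp_and; apply: cp_leq.
Qed.

Lemma cp_const k b : computableb k (fun=> b).
Proof. exact: cf_const. Qed.

Lemma cp_eqb k P Q : computableb k P -> computableb k Q -> computableb k (fun s => P s == Q s).
Proof.
move=> HP HQ; apply: (@cf_ext _ (fun s => (P s : nat) == Q s)); last exact: cp_eq.
by move=> s _; case: (P s); case: (Q s).
Qed.

(** * Bounded search and division *)

Definition bmin n (P : pred nat) := find P (iota 0 n).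
Definition bex n (P : pred nat) := has P (iota 0 n).
Definition ball n (P : pred nat) := all P (iota 0 n).

Lemma cf_bmin k h (P : nat -> seq nat -> bool) :
  computableb k.+1 (fun s => P (head 0 s) (behead s)) -> computable k h ->
  computable k (fun s => bmin (h s) (P^~ s)).
Proof.
move=> HP Hh.
(* After [n] rounds the accumulator is the least solution below [n], or [n] if there is none;
   [y < n] tells that one was found. *)
apply: (@cf_ext _ (fun s => iteri (h s)
   (fun n y => if y.+1 <= n then y else if P n s then n else n.+1) 0)).
  move=> s _; rewrite /bmin; elim: (h s) => // n IH.
  rewrite -[in iota _ _]addn1 iotaD find_cat add0n size_iota has_find size_iota.
  rewrite [LHS]/= IH; case: ltnP => // _.
  by rewrite /=; case: ifP; rewrite ?addn0 ?addn1.
apply: cf_rec => //; first exact: cf_const.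
apply: cf_if; [apply: cp_leq | leaf | apply: cf_if].
- by apply: cf_succ; leaf.
- by leaf.
- apply: (@cf_ext _ (fun s => P (nth 0 s 0) (behead (behead s)))).
    by move=> s _; rewrite nth0.
  apply: (cf_ext _ (cf_comp HP (fs := (fun s => nth 0 s 0) ::
      [seq (fun s => nth 0 s i) | i <- iota 2 k]) _ _)).
  + move=> [|x [|y s]] //= [sz]; congr (nat_of_bool (P _ _)).
    rewrite -map_comp (iotaDl 2 0) -map_comp.
    by apply/esym/(eq_from_nth (x0 := 0)) => [|i Hi];
      rewrite ?size_map ?size_iota // (nth_map 0) ?size_iota -?sz // nth_iota //=.
  + by rewrite /= size_map size_iota.
  + split; first exact: cf_nth.
    by elim: (iota 2 k) => //= i l IH; split=> //; apply: cf_nth.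
- by leaf.
- by apply: cf_succ; leaf.
Qed.

Lemma bexE n P : bex n P = (bmin n P < n).
Proof. by rewrite /bex /bmin has_find size_iota. Qed.

Lemma bexP n (P : pred nat) : reflect (exists2 i, i < n & P i) (bex n P).
Proof.
apply: (iffP hasP) => [[i]|[i Hi Pi]]; first by rewrite mem_iota => Hi Pi; exists i.
by exists i => //; rewrite mem_iota.
Qed.

Lemma ballP n (P : pred nat) : reflect (forall i, i < n -> P i) (ball n P).
Proof.
apply: (iffP allP) => [H i Hi|H i]; first by apply: H; rewrite mem_iota.
by rewrite mem_iota; apply: H.
Qed.

Lemma cp_bex k h (P : nat -> seq nat -> bool) :
  computableb k.+1 (fun s => P (head 0 s) (behead s)) -> computable k h ->
  computableb k (fun s => bex (h s) (P^~ s)).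
Proof.
move=> HP Hh; apply: (@cf_ext _ (fun s => bmin (h s) (P^~ s) < h s)).
  by move=> s _; rewrite bexE.
by apply: cp_leq => //; apply: cf_succ; apply: cf_bmin.
Qed.

Lemma cp_ball k h (P : nat -> seq nat -> bool) :
  computableb k.+1 (fun s => P (head 0 s) (behead s)) -> computable k h ->
  computableb k (fun s => ball (h s) (P^~ s)).
Proof.
move=> HP Hh; apply: (@cf_ext _ (fun s => ~~ bex (h s) (fun i => ~~ P i s))).
  by move=> s _; rewrite /ball /bex -all_predC; congr nat_of_bool; apply: eq_all => i /=; rewrite negbK.
by apply: cp_not; apply: (cp_bex (P := fun i s => ~~ P i s)) => //; apply: cp_not.
Qed.

Lemma bmin_eq n (P : pred nat) m : P m -> m < n -> (forall i, i < m -> ~~ P i) -> bmin n P = m.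
Proof.
move=> Pm mn Hlt; rewrite /bmin -(subnKC mn) iotaD find_cat.
have -> : has P (iota 0 m.+1) by apply/hasP; exists m; rewrite ?mem_iota /=.
rewrite -addn1 iotaD find_cat /= add0n Pm size_iota addn0.
case: ifP => // /hasP[i]; rewrite mem_iota add0n => /= im Pi; by move: (Hlt i im); rewrite Pi.
Qed.

Lemma cf_div k f g : computable k f -> computable k g -> computable k (fun s => f s %/ g s).
Proof.
move=> Hf Hg.
(* The quotient is the least [q] with [f s < q.+1 * g s]; division by 0 yields 0 and is treated
   apart. *)
apply: (@cf_ext _ (fun s => if 0 == g s then 0
                   else bmin (f s).+1 (fun q => (f s).+1 <= q.+1 * g s))).
  move=> s _; case: (posnP (g s)) => [->|g0]; first by rewrite divn0.
  rewrite eq_sym (gtn_eqF g0); apply: bmin_eq.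
  - exact: ltn_ceil.
  - by rewrite ltnS leq_div.
  - move=> i; rewrite -leqNgt leq_divRL // => H; lia.
apply: cf_if; first (apply: cp_eq => //; exact: cf_const); first exact: cf_const.
apply: (cf_bmin (P := fun q s => (f s).+1 <= q.+1 * g s)); last exact: cf_succ.
apply: cp_leq; first by apply: cf_succ; apply: cf_weak.
by apply: cf_mul; [apply: cf_succ; leaf | apply: cf_weak].
Qed.

Lemma cf_mod k f g : computable k f -> computable k g -> computable k (fun s => f s %% g s).
Proof.
move=> Hf Hg; apply: (@cf_ext _ (fun s => f s - f s %/ g s * g s)).
  by move=> s _; rewrite {1}(divn_eq (f s) (g s)) addKn.
by apply: cf_sub => //; apply: cf_mul => //; apply: cf_div.
Qed.

(** * Numbers as padded words *)

Section Coding.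
Context (K : nat).
Notation c := K.+2.

Definition dig x i := (x %/ c ^ i) %% c.
(* The digit 0 is read as the invalid letter [K.+1]; it marks the end of the word. *)
Definition letter x i := K.+1 - dig x i.
Definition pre T x := mkseq (letter x) T.
(** The search always succeeds: digit [x] of [x] is 0 because [x < c ^ x]. *)
Definition sz x := bmin x.+1 (fun i => dig x i == 0).
Definition dec x := pre (sz x) x.
(** Letters are complemented so that each letter up to [K] gets a nonzero digit and 0 stays free for
    padding. *)
Definition enc w := foldr (fun a e => (K.+1 - a) + c * e) 0 w.

Lemma expc_gt0 j : 0 < c ^ j. Proof. by rewrite expn_gt0. Qed.

Lemma ltn_expc x : x < c ^ x. Proof. exact: ltn_expl. Qed.

Lemma dig_lt x i : dig x i < c. Proof. by rewrite ltn_pmod. Qed.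

Lemma dig_small j x i : x < c ^ j -> j <= i -> dig x i = 0.
Proof.
move=> xj ji; rewrite /dig divn_small ?mod0n //.
by apply: leq_trans xj _; rewrite leq_pexp2l.
Qed.

(** For [x0 < c ^ j] no carry occurs: the sum places the digits of [x] behind the [j] low digits
    given by [x0]. *)
Lemma dig_mix j x0 x i : x0 < c ^ j ->
  dig (x0 + c ^ j * x) i = if i < j then dig x0 i else dig x (i - j).
Proof.
move=> xj; rewrite /dig; case: ltnP => ij.
  have -> : x0 + c ^ j * x = c * (c ^ (j - i).-1 * x) * c ^ i + x0.
    rewrite addnC; congr addn; rewrite mulnA -expnS mulnAC -expnD; congr (c ^ _ * _); lia.
  by rewrite divnMDl ?expc_gt0 // mulnC modnMDl.
rewrite -{1}(subnKC ij) expnD divnMA addnC mulnC divnMDl ?expc_gt0 //.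
by rewrite (divn_small xj) addn0.
Qed.

Lemma dig_sz x : dig x (sz x) = 0.
Proof.
have h : has (fun i => dig x i == 0) (iota 0 x.+1).
  by apply/hasP; exists x; rewrite ?mem_iota //= (dig_small (ltn_expc x)).
have := nth_find 0 h; rewrite nth_iota; first by rewrite add0n => /eqP.
by move: h; rewrite has_find size_iota.
Qed.

Lemma dig_lt_sz x i : i < sz x -> dig x i != 0.
Proof.
move=> lt; have := before_find 0 lt; rewrite nth_iota ?add0n; first by move->.
by apply: leq_trans lt _; rewrite -[leqRHS](size_iota 0 x.+1) find_size.
Qed.

Lemma sz_uniq x s : dig x s = 0 -> (forall i, i < s -> dig x i != 0) -> sz x = s.
Proof.
move=> d0 dn; apply/eqP; rewrite eqn_leq; apply/andP; split; rewrite leqNgt; apply/negP.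
  by move/dig_lt_sz; rewrite d0.
by move/dn; rewrite dig_sz.
Qed.

Lemma sz_lt j x : x < c ^ j -> sz x <= j.
Proof. by move=> xj; rewrite leqNgt; apply/negP=> /dig_lt_sz; rewrite (dig_small xj). Qed.

Lemma sz_le x : sz x <= x.
Proof. exact: sz_lt (ltn_expc x). Qed.

Lemma size_dec x : size (dec x) = sz x.
Proof. by rewrite size_mkseq. Qed.

Lemma pre_mix j x0 x T : x0 < c ^ j -> T <= j -> pre T (x0 + c ^ j * x) = pre T x0.
Proof.
move=> xj Tj; apply/eq_in_map => i; rewrite mem_iota add0n => /= iT.
by rewrite /letter dig_mix // (leq_trans iT).
Qed.

Lemma pre_mixD j x0 x T : x0 < c ^ j -> pre (j + T) (x0 + c ^ j * x) = pre j x0 ++ pre T x.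
Proof.
move=> xj; rewrite /pre /mkseq iotaD map_cat; congr cat; first exact: pre_mix.
rewrite add0n -[j in iota j]addn0 iotaDl -map_comp; apply: eq_map => i /=.
by rewrite /letter dig_mix // ltnNge leq_addr /= addKn.
Qed.

(** If the word of [x0] is shorter than [j], a padding digit precedes the digits of [x] and hides
    them. *)
Lemma dec_mix j x0 x : x0 < c ^ j ->
  dec (x0 + c ^ j * x) = if sz x0 == j then dec x0 ++ dec x else dec x0.
Proof.
move=> xj; case: ifPn => [/eqP sj|sj]; rewrite /dec.
  have -> : sz (x0 + c ^ j * x) = j + sz x.
    apply: sz_uniq => [|i ij]; first by rewrite dig_mix // ltnNge leq_addr /= addKn dig_sz.
    rewrite dig_mix //; case: ltnP => lt; first by rewrite dig_lt_sz // sj.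
    by rewrite dig_lt_sz //; lia.
  by rewrite pre_mixD // sj.
have {}sj : sz x0 < j by rewrite ltn_neqAle sj sz_lt.
have -> : sz (x0 + c ^ j * x) = sz x0.
  apply: sz_uniq => [|i ij]; first by rewrite dig_mix // sj dig_sz.
  by rewrite dig_mix // (ltn_trans ij sj) dig_lt_sz.
by rewrite pre_mix // ltnW.
Qed.

Lemma take_dec T x : T <= sz x -> take T (dec x) = pre T x.
Proof. by move=> Tx; rewrite -map_take take_iota (minn_idPl Tx). Qed.

Lemma enc_cat u v : enc (u ++ v) = enc u + c ^ size u * enc v.
Proof.
elim: u => [|a u /= ->]; first by rewrite /= mul1n.
by rewrite mulnDr mulnA expnS addnA.
Qed.

Lemma enc_lt w : enc w < c ^ size w.
Proof.
elim: w => //= a w IH; rewrite expnS.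
have : (K.+1 - a) + c * enc w < c * (enc w).+1 by rewrite mulnS; lia.
by move=> H; apply: leq_trans H _; rewrite leq_pmul2l.
Qed.

Lemma dig_enc w i : all (leq^~ K) w ->
  dig (enc w) i = if i < size w then K.+1 - nth 0 w i else 0.
Proof.
elim: w i => [|a w IH] i /=; first by rewrite /dig div0n mod0n.
move=> /andP[aK /IH{}IH].
have := @dig_mix 1 (K.+1 - a) (enc w) i; rewrite expn1 => ->; last by lia.
case: i => [|i] /=; first by rewrite /dig expn0 divn1 modn_small //; lia.
by rewrite subn1 /= IH ltnS.
Qed.

Lemma sz_enc w : all (leq^~ K) w -> sz (enc w) = size w.
Proof.
move=> aw; apply: sz_uniq => [|i iw]; first by rewrite dig_enc // ltnn.
rewrite dig_enc // iw; move/(all_nthP 0)/(_ _ iw): aw; lia.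
Qed.

Lemma enc_leK w : all (leq^~ K) w -> dec (enc w) = w.
Proof.
move=> aw; rewrite /dec sz_enc //; apply: (eq_from_nth (x0 := 0)); rewrite size_mkseq // => i iw.
rewrite nth_mkseq // /letter dig_enc // iw; move/(all_nthP 0)/(_ _ iw): aw; lia.
Qed.

Lemma encK w : all (fun a => a < K) w -> dec (enc w) = w.
Proof. by move=> aw; apply: enc_leK; apply: sub_all aw => a /ltnW. Qed.

Lemma dec_le x : all (leq^~ K) (dec x).
Proof.
apply/(all_nthP 0) => i; rewrite size_dec => ix; rewrite nth_mkseq // /letter.
by move: (dig_lt_sz ix); lia.
Qed.

End Coding.

(** * Predicates with finitely many residuals *)

Lemma pigeonhole (T : finType) n (f : nat -> T) : #|T| <= n ->
  exists i i', [/\ i < i', i' <= n & f i = f i'].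
Proof.
move=> cT; apply: contrapT => H.
have inj : injective (fun i : 'I_n.+1 => f i).
  move=> i i' E; apply: val_inj => /=.
  case: (ltngtP i i') => // lt; case: H.
    by exists i, i'; split=> //; rewrite -ltnS.
  by exists i', i; split=> //; rewrite -ltnS.
by have := leq_card _ inj; rewrite card_ord => /leq_trans/(_ cT); rewrite ltnn.
Qed.

Lemma card_pset (T : finType) : #|{set T}| = 2 ^ #|T|.
Proof. by rewrite -[in RHS]cardsT -card_powerset powersetT cardsT. Qed.

(** Assignments to de Bruijn variables; [scons] supplies the innermost quantified variable and
    shifts the others. *)
Definition env := nat -> nat.
Definition scons x (a : env) : env := fun i => if i is i'.+1 then a i' else x.

Section Idx.
Context (K : nat).
Notation c := K.+2.

(** All variables are read in parallel: [a] holds the [j] digits already read of each, [b] what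
    follows. *)
Definition mix j (a b : env) : env := fun i => a i + c ^ j * b i.
Definition bounded j (a : env) := forall i, a i < c ^ j.

(* [key j a] determines the residual of [P] after the [j] lowest digits [a]. *)
Definition idx n (P : env -> Prop) := exists (T : finType) (key : nat -> env -> T),
  #|T| <= n /\ forall j a j' a' b, bounded j a -> bounded j' a' ->
    key j a = key j' a' -> P (mix j a b) -> P (mix j' a' b).

Lemma idx_ext n P Q : (forall a, P a <-> Q a) -> idx n P -> idx n Q.
Proof.
move=> PQ [T [key [cT H]]]; exists T, key; split=> // j a j' a' b ba ba' E /PQ HP.
by apply/PQ; apply: H E HP.
Qed.

Lemma idx_not n P : idx n P -> idx n (fun a => ~ P a).
Proof.
move=> [T [key [cT H]]]; exists T, key; split=> // j a j' a' b ba ba' E HP HP'.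
by apply: HP; apply: H HP'.
Qed.

Lemma idx_and n n' P Q : idx n P -> idx n' Q -> idx (n * n') (fun a => P a /\ Q a).
Proof.
move=> [T [key [cT H]]] [T' [key' [cT' H']]].
exists (T * T')%type, (fun j a => (key j a, key' j a)); split.
  by rewrite card_prod leq_mul.
move=> j a j' a' b ba ba' [E E'] [HP HQ]; split; first exact: H E HP.
exact: H' E' HQ.
Qed.

Lemma idx_iff n n' P Q : idx n P -> idx n' Q -> idx (n * n') (fun a => P a <-> Q a).
Proof.
move=> [T [key [cT H]]] [T' [key' [cT' H']]].
exists (T * T')%type, (fun j a => (key j a, key' j a)); split.
  by rewrite card_prod leq_mul.
move=> j a j' a' b ba ba' [E E'] [HPQ HQP]; split=> [HP|HQ].
  by apply: H' E' _ => //; apply: HPQ; apply: H HP.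
by apply: H E _ => //; apply: HQP; apply: H' HQ.
Qed.

Lemma idx_sub n P (f : nat -> nat) : idx n P -> idx n (fun a => P (fun i => a (f i))).
Proof.
move=> [T [key [cT H]]]; exists T, (fun j a => key j (fun i => a (f i))); split=> //.
by move=> j a j' a' b ba ba' E; apply: H E => i; [apply: ba | apply: ba'].
Qed.

Lemma scons_mix j x0 x a b :
  scons (x0 + c ^ j * x) (mix j a b) = mix j (scons x0 a) (scons x b).
Proof. by apply: funext => -[]. Qed.

Lemma bounded_scons j x a : x < c ^ j -> bounded j a -> bounded j (scons x a).
Proof. by move=> xj ba []. Qed.

(** Subset construction: the new key collects the old keys over all choices of [j] low digits for
    the quantified number. *)
Lemma idx_ex n P : idx n P -> idx (2 ^ n) (fun a => exists x, P (scons x a)).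
Proof.
move=> [T [key [cT H]]].
exists {set T}, (fun j a => [set t | `[< exists2 x0, x0 < c ^ j & key j (scons x0 a) = t >]]).
split; first by rewrite card_pset leq_pexp2l.
move=> j a j' a' b ba ba' E [x]; rewrite (divn_eq x (c ^ j)) addnC mulnC scons_mix => HP.
have xj : x %% c ^ j < c ^ j by rewrite ltn_mod expc_gt0.
have : key j (scons (x %% c ^ j) a) \in
    [set t | `[< exists2 x0, x0 < c ^ j & key j (scons x0 a) = t >]].
  by rewrite inE; apply/asboolP; exists (x %% c ^ j).
rewrite E inE => /asboolP[x1 x1j E1]; exists (x1 + c ^ j' * (x %/ c ^ j)).
by rewrite scons_mix; apply: H HP; try exact: bounded_scons.
Qed.

Lemma idx_all n P : idx n P -> idx (2 ^ n) (fun a => forall x, P (scons x a)).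
Proof.
move=> /idx_not/idx_ex/idx_not; apply: idx_ext => a; split=> [H x|H [x Hx]].
  by apply: contrapT => Hx; apply: H; exists x.
exact: Hx (H x).
Qed.

(** High digits dominate: the low digits matter only if the parts still to be read are equal, and
    then only through their own comparison. *)
Lemma idx_le p q : idx 2 (fun a => a p <= a q).
Proof.
exists bool, (fun j a => a p <= a q); split; first by rewrite card_bool.
move=> j a j' a' b ba ba'; rewrite /mix => E.
move: (ba p) (ba q) (ba' p) (ba' q) E.
case: (ltngtP (b p) (b q)) => [lt|lt|->].
- move=> _ _ h _ _ _; apply: leq_trans (leq_addl _ _).
  apply: leq_trans (_ : c ^ j' * (b p).+1 <= _); last by rewrite leq_mul2l lt orbT.
  by rewrite mulnS leq_add2r ltnW.
- move=> _ h _ _ _ /(leq_trans _) H; exfalso.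
  have : c ^ j * (b q).+1 <= a q + c ^ j * b q.
    by apply: H; rewrite (leq_trans _ (leq_addl _ _)) // leq_mul2l lt orbT.
  by rewrite mulnS leq_add2r leqNgt h.
- by rewrite !leq_add2r => _ _ _ _ ->.
Qed.

(** A least witness with more than [j + n] digits would have two cuts with equal keys, at places
    where the other variables have no digits left; deleting the digits in between would give a
    smaller witness. *)
Lemma idx_pump n P j a : idx n P -> bounded j a -> (exists x, P (scons x a)) ->
  exists2 x, x < c ^ (j + n) & P (scons x a).
Proof.
move=> [T [key [cT H]]] ba [x0 Px0].
have ex : exists x, `[< P (scons x a) >] by exists x0; apply/asboolP.
case: (ex_minnP ex) => x /asboolP Px xmin; exists x => //; rewrite ltnNge; apply/negP => big.
have [i [i' [ii' i'n E]]] :=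
  pigeonhole (fun i => key (j + i) (scons (x %% c ^ (j + i)) a)) cT.
have ba2 k : bounded (j + k) (scons (x %% c ^ (j + k)) a).
  apply: bounded_scons; first by rewrite ltn_mod expc_gt0.
  by move=> s; apply: leq_trans (ba s) _; rewrite leq_pexp2l // leq_addr.
have xE k y : mix (j + k) (scons (x %% c ^ (j + k)) a) (scons y (fun=> 0))
    = scons (x %% c ^ (j + k) + c ^ (j + k) * y) a.
  by rewrite -scons_mix; congr scons; apply: funext => s; rewrite /mix muln0 addn0.
set y := x %/ c ^ (j + i').
have /xmin : `[< P (scons (x %% c ^ (j + i) + c ^ (j + i) * y) a) >].
  apply/asboolP; rewrite -xE; apply: H (esym E) _ => //.
  by rewrite xE addnC mulnC -divn_eq.
have y0 : 0 < y.
  by rewrite divn_gt0 ?expc_gt0 // (leq_trans _ big) // leq_pexp2l // leq_add2l.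
rewrite leqNgt => /negP; apply.
rewrite {2}(divn_eq x (c ^ (j + i'))) -/y.
(* The shortened number is below [c ^ (j + i) * y.+1], which is at most [c ^ (j + i') * y] since
   [y > 0], [c >= 2] and [i < i']. *)
apply: leq_trans (_ : c ^ (j + i) * y.+1 <= _).
  by rewrite mulnS ltn_add2r ltn_mod expc_gt0.
apply: leq_trans (leq_addr _ _); rewrite [leqRHS]mulnC.
apply: leq_trans (_ : c ^ (j + i) * (2 * y) <= _); first by rewrite leq_mul2l; lia.
rewrite mulnA leq_mul2r; apply/orP; right.
apply: leq_trans (_ : c ^ (j + i) * c <= _); first by rewrite leq_mul2l; lia.
by rewrite -expnSr leq_pexp2l //; lia.
Qed.

End Idx.

(** * Finite shiftlag *)

Lemma filter_predC T (p : pred T) s : filter (predC (predC p)) s = filter p s.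
Proof. by apply: eq_filter => x /=; rewrite negbK. Qed.

Lemma filter_all_predC T (p : pred T) s : all (predC p) s -> filter p s = [::].
Proof. by elim: s => //= x s IH /andP[/negbTE-> /IH]. Qed.

Lemma filter_cat_split T (p : pred T) w u v : filter p w = u ++ v ->
  exists w0 w1, [/\ w = w0 ++ w1, filter p w0 = u & filter p w1 = v].
Proof.
elim: w u => [|a w IH] [|x u] //=; first by exists [::], [::].
  by exists [::], (a :: w); split.
case: ifP => pa.
  case=> <- /IH[w0 [w1 [-> E0 E1]]]; exists (a :: w0), w1; split=> //=.
  by rewrite pa E0.
move=> /(IH (x :: u))[w0 [w1 [-> E0 E1]]]; exists (a :: w0), w1; split=> //=.
by rewrite pa E0.
Qed.

Lemma cat_prefix T (a b c d : seq T) : a ++ b = c ++ d -> size a <= size c ->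
  exists e, c = a ++ e /\ b = e ++ d.
Proof.
elim: a c => [|x a IH] [|y c] //=; first by move=> ->; exists [::].
  by move=> ->; exists (y :: c).
by case=> -> /IH H /H[e [-> ->]]; exists e.
Qed.

Lemma span_split T (p : pred T) w : exists u v,
  [/\ w = u ++ v, all p u & if v is x :: _ then ~~ p x else true].
Proof.
elim: w => [|x w [u [v [-> pu pv]]]]; first by exists [::], [::].
case px: (p x); first by exists (x :: u), v; rewrite /= px.
by exists [::], (x :: u ++ v); rewrite /= px.
Qed.

(** * Decomposition of words into alternating blocks *)

Definition zipcat T (xs bs : seq (seq T)) := flatten [seq t.1 ++ t.2 | t <- zip xs bs].

Lemma zipcat_nil T k : zipcat (nseq k [::]) (nseq k [::]) = [::] :> seq T.
Proof. by elim: k. Qed.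

Definition mixed T (p : pred T) (u : seq T) := has p u && has (predC p) u.

(** Cut off, up to [k] times, a maximal [p]-block and the maximal block of other letters after it.
    If the word ends early, empty blocks fill up the lists; otherwise each pair cut off is mixed. *)
Lemma blocks_head T (p : pred T) k w : (if w is x :: _ then p x else true) ->
  (exists xs bs, [/\ size xs = k, size bs = k, all (all p) xs, all (all (predC p)) bs
      & w = zipcat xs bs]) \/
  (exists us v, [/\ size us = k, all (mixed p) us & w = flatten us ++ v]).
Proof.
elim: k w => [|k IH] w hw; first by right; exists [::], w.
have [xi [v [wE axi hv]]] := span_split p w.
have [be [v' [vE abe hv']]] := span_split (predC p) v.
have hv2 : if v' is x :: _ then p x else true by case: v' hv' {vE} => //= x _; rewrite negbK.
case: v' => [|y v'] in vE hv' hv2.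
  left; exists (xi :: nseq k [::]), (be :: nseq k [::]).
  by rewrite /= !size_nseq !all_nseq axi abe !orbT wE vE /zipcat /= -/(zipcat _ _) zipcat_nil !cats0.
case: (IH (y :: v') hv2) => [[xs [bs [sx sb ax ab E]]]|[us [v2 [su au E]]]].
  left; exists (xi :: xs), (be :: bs); rewrite /= sx sb axi ax abe ab; split=> //.
  by rewrite wE vE E /zipcat /= -catA.
right; exists ((xi ++ be) :: us), v2; rewrite /= su au andbT; split=> //; last first.
  by rewrite wE vE E !catA.
rewrite /mixed !has_cat.
case: be vE abe {E} => [/= vE|b be vE /= /andP[nb _]]; first by move: hv; rewrite vE hv2.
rewrite /= nb orbT andbT.
by case: xi wE axi => [/= wE|a xi _ /= /andP[->]] //; move: hw hv; rewrite wE vE /= => ->.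
Qed.

(** An initial run of letters outside [p] is put behind an empty first [p]-block, which costs one
    more pair. *)
Lemma blocks T (p : pred T) k w :
  (exists xs bs, [/\ size xs = k.+1, size bs = k.+1, all (all p) xs, all (all (predC p)) bs
      & w = zipcat xs bs]) \/
  (exists u0 us v, [/\ size us = k, all (mixed p) us & w = u0 ++ flatten us ++ v]).
Proof.
have [u0 [v [-> au0 hv]]] := span_split (predC p) w.
have hv2 : is_true (if v is x :: _ then p x else true) by case: v hv => //= x; rewrite negbK.
case: (blocks_head k hv2) => [[xs [bs [sx sb ax ab ->]]]|[us [v2 [su au ->]]]].
  by left; exists ([::] :: xs), (u0 :: bs); rewrite /= sx sb ax ab au0.
by right; exists u0, us, v2.
Qed.

Lemma count_mixed T (p : pred T) us : all (mixed p) us ->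
  size us <= count (predC p) (flatten us).
Proof.
elim: us => //= u us IH /andP[/andP[_]]; rewrite has_count count_cat => h /IH; lia.
Qed.

Lemma has_flatten_mixed T (p : pred T) us : all (mixed p) us -> 0 < size us ->
  mixed p (flatten us).
Proof. by case: us => //= u us /andP[/andP[h1 h2] _] _; rewrite /mixed !has_cat h1 h2. Qed.

(** * Loops in the run of an automaton *)

Section Loops.
Context (st : nat -> nat -> nat) (n : nat).
Context (st_le : forall q a, st q a <= n).
Notation N := n.+1.
Notation runf := (foldl st).

Lemma runf_lt q w : q < N -> runf q w < N.
Proof. by elim: w q => //= a w IH q _; apply: IH; rewrite ltnS. Qed.

Lemma pigeonhole_nat (f : nat -> nat) : (forall i, f i < N) ->
  exists i i', [/\ i < i', i' <= N & f i = f i'].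
Proof.
move=> fN; have [|i [i' [ii' i'N E]]] := @pigeonhole 'I_N N (fun i => inord (f i)).
  by rewrite card_ord.
by exists i, i'; split=> //; move/(congr1 val): E; rewrite /= !inordK.
Qed.

(** The obstruction to finite shiftlag: iterating [l1] makes the lag grow, and iterating the later
    loop [l2] adds shifts. *)
Definition loop_pair (p : pred nat) w := exists p1 l1 p2 l2 p3,
  [/\ w = p1 ++ l1 ++ p2 ++ l2 ++ p3, runf 0 (p1 ++ l1) = runf 0 p1,
      runf 0 (p1 ++ l1 ++ p2 ++ l2) = runf 0 (p1 ++ l1 ++ p2),
      count p l1 != count (predC p) l1 & mixed p l2].

(** Discrete intermediate values: the difference of the two counts starts at 0 and moves by one per
    letter. *)
Lemma prefix_drift (p : pred nat) w v : count (predC p) w + v <= count p w ->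
  exists t s, w = t ++ s /\ count p t = count (predC p) t + v.
Proof.
elim/last_ind: w v => [|w a IH] v.
  by rewrite /= add0n leqn0 => /eqP->; exists [::], [::].
rewrite -cats1 !count_cat /= !addn0 => H.
have [h|h] := leqP (count (predC p) w + v) (count p w).
  have [t [s [-> E]]] := IH v h; exists t, (s ++ [:: a]); split=> //; by rewrite catA.
exists (w ++ [:: a]), [::]; rewrite cats0; split=> //.
by rewrite !count_cat /= !addn0; case: (p a) H h => /=; lia.
Qed.

Lemma drift_loop (p : pred nat) w : count (predC p) w + N <= count p w ->
  exists p1 l1 p2, [/\ w = p1 ++ l1 ++ p2, runf 0 (p1 ++ l1) = runf 0 p1
     & count p l1 != count (predC p) l1].
Proof.
move=> H.
(* [t v] is a prefix of drift [v]. Among [v = 0, ..., N] two prefixes reach the same state, and the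
   factor between them is a loop of nonzero drift. *)
have /choice[t Ht] : forall v, exists t, v <= N -> exists s, w = t ++ s /\ count p t = count (predC p) t + v.
  move=> v; case: (leqP v N) => vN; last by exists [::].
  by have [|t [s E]] := @prefix_drift p w v; [lia | exists t => _; exists s].
have [i [i' [ii' i'N E]]] := pigeonhole_nat (f := fun i => runf 0 (t i)) (fun i => runf_lt _ (ltn0Sn n)).
have [s [wE c1]] := Ht i ltac:(lia).
have [s' [wE' c2]] := Ht i' i'N.
case: (leqP (size (t i)) (size (t i'))) => [le|/ltnW le].
  have := cat_prefix (etrans (esym wE) wE') le => -[e [tE sE]].
  exists (t i), e, s'; rewrite -sE -tE; split=> //.
  by move: c2 c1; rewrite tE !count_cat; lia.
have := cat_prefix (etrans (esym wE') wE) le => -[e [tE sE]].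
exists (t i'), e, s; rewrite -sE -tE; split=> //.
by move: c2 c1; rewrite tE !count_cat; lia.
Qed.

(** Two of the [N + 1] cuts around the [N] pieces meet the same state, and a nonempty row of mixed
    pieces is mixed. *)
Lemma mixed_loop (p : pred nat) q us : q < N -> size us = N -> all (mixed p) us ->
  exists p1 l p2, [/\ flatten us = p1 ++ l ++ p2, runf q (p1 ++ l) = runf q p1 & mixed p l].
Proof.
move=> qN sus aus.
have [i [i' [ii' i'N E]]] :=
  pigeonhole_nat (f := fun i => runf q (flatten (take i us))) (fun i => runf_lt _ qN).
exists (flatten (take i us)), (flatten (drop i (take i' us))), (flatten (drop i' us)).
have tE : take i us ++ drop i (take i' us) = take i' us.
  by rewrite -[RHS](cat_take_drop i) take_takel // ltnW.
split.
- by rewrite -!flatten_cat catA tE cat_take_drop.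
- by rewrite -flatten_cat tE.
- apply: has_flatten_mixed; last by rewrite size_drop size_takel ?subn_gt0 // sus.
  apply/allP => u /mem_drop/mem_take; exact: (allP aus).
Qed.

(* If [v] had too many blocks, then the second component would lag by [N] letters
   after [w0], which needs a loop with nonzero drift, and [v] has a mixed loop. *)
Lemma catch_up (p : pred nat) w0 v w1 :
  ~ loop_pair p (w0 ++ v ++ w1) ->
  filter p v = [::] \/ count (predC p) (w0 ++ v) <= count p w0 ->
  exists xs bs, [/\ size xs = N.+1, size bs = N.+1, all (all p) xs, all (all (predC p)) bs
      & v = zipcat xs bs].
Proof.
move=> nl [fv|le].
  exists ([::] :: nseq N [::]), (v :: nseq N [::]).
  rewrite /= !size_nseq !all_nseq /= !orbT andbT; split=> //.
    by rewrite all_predC has_filter fv.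
  by rewrite /zipcat [zip _ _]/= map_cons /= -/(zipcat (nseq n [::]) (nseq n [::])) zipcat_nil cats0.
case: (blocks p N v) => // -[u0 [us [v2 [sus aus vE]]]]; case: nl.
have := count_mixed aus; rewrite sus => cN.
(* The [N] mixed pieces of [v] contain at least [N] letters outside [p], so [le] forces a drift of
   at least [N] on [w0] alone. *)
have [|p1 [l1 [p2 [w0E E1 d1]]]] := @drift_loop p w0.
  by move: le; rewrite vE !count_cat; lia.
have [p3 [l2 [p4 [uE E2 m2]]]] := mixed_loop (runf_lt (w0 ++ u0) (ltn0Sn n)) sus aus.
exists p1, l1, (p2 ++ u0 ++ p3), l2, (p4 ++ v2 ++ w1); split=> //.
  by rewrite vE w0E uE !catA.
by move: E2; rewrite -!foldl_cat w0E -!catA.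
Qed.
End Loops.

(** * Pumping a loop pair *)

Definition rep T n (l : seq T) := flatten (nseq n l).

Lemma repS T n (l : seq T) : rep n.+1 l = l ++ rep n l. Proof. by []. Qed.

Lemma size_rep T n (l : seq T) : size (rep n l) = n * size l.
Proof. by elim: n => // n IH; rewrite repS size_cat IH. Qed.

Lemma count_rep T (p : pred T) n l : count p (rep n l) = n * count p l.
Proof. by elim: n => // n IH; rewrite repS count_cat IH. Qed.

Lemma nth_rep T (x0 : T) n l t i : i < size l -> t < n ->
  nth x0 (rep n l) (t * size l + i) = nth x0 l i.
Proof.
move=> il; elim: n t => // n IH [|t] tn; rewrite repS nth_cat.
  by rewrite mul0n add0n il.
rewrite mulSn -addnA ltnNge leq_addr /= addKn; exact: IH.
Qed.

Lemma rep_all T (p : pred T) n l : all p l -> all p (rep n l).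
Proof. by move=> h; elim: n => // n IH; rewrite repS all_cat h. Qed.

Lemma foldl_rep T S (f : S -> T -> S) q n l : foldl f q l = q -> foldl f q (rep n l) = q.
Proof. by move=> h; elim: n => // n IH; rewrite repS foldl_cat h. Qed.

(** Supplies a shift strictly inside each copy of a mixed loop, whatever surrounds the copy. *)
Lemma mixed_adjacent (p : pred nat) l : mixed p l ->
  exists2 i, i.+1 < size l & p (nth 0 l i) != p (nth 0 l i.+1).
Proof.
rewrite /mixed; elim: l => //= a l IH.
case hl: (has p l && has (predC p) l).
  by move=> _; have [i il Hi] := IH hl; exists i.+1.
case: l {IH} hl => [|b l]; first by rewrite /= !orbF andbN.
have [E|] := boolP (p a == p b); last by move=> nE _ _; exists 0.
by rewrite /= (eqP E); case: (p b); rewrite //= ?orbT ?andbT => ->.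
Qed.

Lemma count_windows (P : pred nat) s L n :
  (forall t, t < n -> has P (iota (s + t * L) L)) -> n <= count P (iota s (n * L)).
Proof.
elim: n => // n IH H; rewrite mulSnr iotaD count_cat -addn1 leq_add //.
  by apply: IH => t tn; apply: H; apply: ltnW.
by rewrite -has_count; apply: H.
Qed.

Lemma is_word_predC ns ng w : is_word ns ng w ->
  filter (inGamma ns ng) w = filter (predC (inSigma ns)) w.
Proof.
move=> /allP h; apply: eq_in_filter => a /h; rewrite /inGamma /inSigma /= => ->.
by rewrite andbT ltnNge negbK.
Qed.

Lemma is_word_count ns ng w : is_word ns ng w ->
  count (inGamma ns ng) w = count (predC (inSigma ns)) w.
Proof. by move=> h; rewrite -!size_filter is_word_predC. Qed.

(** Shifts are listed in increasing order, so those in the window form a segment of the list, which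
    starts after the shifts lying before the window. *)
Lemma has_block_of_window ns ng W a b n :
  a + b < size W -> n <= count (is_shift ns W) (iota a.+1 b) ->
  (forall i, a < i <= a + b -> n <= lag ns ng W i) -> has_lagged_shift_block ns ng W n.
Proof.
move=> ab cn H.
have sE : shifts ns W = filter (is_shift ns W) (iota 1 a) ++
   filter (is_shift ns W) (iota a.+1 b) ++
   filter (is_shift ns W) (iota (a + b).+1 ((size W).-1 - a - b)).
  rewrite /shifts -!filter_cat; congr filter.
  by rewrite -[a.+1]add1n -[(a + b).+1]add1n addnA -!iotaD; congr iota; lia.
exists (size (filter (is_shift ns W) (iota 1 a))).
rewrite sE !size_cat; split.
  by rewrite leq_add2l; apply: leq_trans (leq_addr _ _); rewrite size_filter.
move=> j jn; rewrite nth_cat ltnNge leq_addr /= addKn nth_cat size_filter (leq_trans jn cn).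
apply: H; set x := nth _ _ _.
have : x \in filter (is_shift ns W) (iota a.+1 b).
  by apply: mem_nth; rewrite size_filter (leq_trans jn cn).
rewrite mem_filter mem_iota => /andP[_]; lia.
Qed.

Definition step (A : dfa) q a := nth 0 (nth [::] (delta A) q) a.

(** Pumping [l1] creates a large lag and pumping [l2] afterwards creates many shifts, so the pumped
    word, still in the language, has [B.+1] consecutive shifts that violate the bound [B]. *)
Lemma no_loop_pair ns ng A w : finite_shiftlag ns ng (dfa_lang ns ng A) ->
  dfa_lang ns ng A w -> ~ loop_pair (step A) (inSigma ns) w.
Proof.
move=> [B HB] Sw [p1 [l1 [p2 [l2 [p3 [wE E1 E2 d1 m2]]]]]].
(* The first [n] copies of [l2] give one shift each; the extra copy keeps these positions away from
   the end of [W]. *)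
pose n := B.+1; have [M ME] : exists M, M = rep n.+1 l2 by eexists.
(* The [a] copies of [l1] drift by at least [a] in one direction; [p1], [p2] and a prefix of [M] can
   cancel at most their lengths, which leaves [n]. *)
have [a aE] : exists a, a = n + size p1 + size p2 + size M by eexists.
pose P := p1 ++ rep a l1 ++ p2; pose W := P ++ M ++ p3.
have wW : is_word ns ng W.
  move: Sw; rewrite /dfa_lang wE /is_word /W /P !all_cat -!andbA.
  by case/and5P=> -> h1 -> h2 /andP[-> _]; rewrite ME !rep_all ?h1 ?h2.
have SW : dfa_lang ns ng A W.
  move: E1 E2; rewrite !foldl_cat => E1; rewrite E1 => E2.
  have F1 := foldl_rep a E1; have F2 := foldl_rep n.+1 E2.
  have FP : foldl (step A) 0 P = foldl (step A) (foldl (step A) 0 p1) p2.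
    by rewrite /P (foldl_cat _ _ p1) (foldl_cat _ _ (rep a l1)) F1.
  have Fw : run A w = foldl (step A) (foldl (step A) (foldl (step A) 0 p1) p2) p3.
    by rewrite wE /run -/(step A) !foldl_cat E1 E2.
  have FW : run A W = run A w.
    by rewrite Fw /run -/(step A) /W (foldl_cat _ _ P) (foldl_cat _ _ M) FP ME F2.
  by rewrite /dfa_lang wW FW; case/andP: Sw.
have [i0 i0l Hi0] := mixed_adjacent m2.
have sM : size M = n * size l2 + size l2 by rewrite ME size_rep mulSnr.
suff /(HB W SW) : has_lagged_shift_block ns ng W n by rewrite ltnn.
apply: (@has_block_of_window _ _ _ (size P) (n * size l2)).
- by rewrite !size_cat sM; lia.
- apply: count_windows => t tn; apply/hasP.
  exists ((size P).+1 + t * size l2 + i0); first by rewrite mem_iota; lia.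
  have tl : t * size l2 + size l2 <= n * size l2 by rewrite -mulSnr leq_mul2r tn orbT.
  have WE i : i < size l2 -> nth 0 W (size P + (t * size l2 + i)) = nth 0 l2 i.
    move=> il; rewrite nth_cat ltnNge leq_addr /= addKn nth_cat sM.
    by rewrite (_ : t * _ + i < _) ?ME ?nth_rep //; lia.
  rewrite /is_shift -andbA; apply/and3P; split; first by lia.
    by rewrite !size_cat sM; lia.
  have -> : ((size P).+1 + t * size l2 + i0).-1 = size P + (t * size l2 + i0) by lia.
  have -> : (size P).+1 + t * size l2 + i0 = size P + (t * size l2 + i0.+1) by lia.
  by rewrite !WE //; lia.
- move=> i /andP[iP iM]; rewrite /lag.
  have -> : take i W = P ++ take (i - size P) M.
    rewrite take_cat ltnNge ltnW //= takel_cat //; lia.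
  have wP : is_word ns ng (P ++ take (i - size P) M).
    move: wW; rewrite /is_word /W !all_cat => /andP[-> /andP[aM _]] /=.
    by apply/allP => x /mem_take; apply: (allP aM).
  rewrite (is_word_count wP) !count_cat !count_rep.
  have bnd (p : pred nat) s : count p s <= size s by apply: count_size.
  have := bnd (inSigma ns) p1; have := bnd (predC (inSigma ns)) p1.
  have := bnd (inSigma ns) p2; have := bnd (predC (inSigma ns)) p2.
  have := bnd (inSigma ns) (take (i - size P) M).
  have := bnd (predC (inSigma ns)) (take (i - size P) M).
  have : size (take (i - size P) M) <= size M by rewrite size_take; case: ltnP; lia.
  move: d1; rewrite neq_ltn => /orP[] /(leq_mul (leqnn a)); rewrite mulnS.
  all: lia.
Qed.

Lemma loop_pair_predC st (p : pred nat) w : loop_pair st (predC p) w -> loop_pair st p w.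
Proof.
move=> [p1 [l1 [p2 [l2 [p3 [wE E1 E2 d1 m2]]]]]]; exists p1, l1, p2, l2, p3; split=> //.
  have cE : count (predC (predC p)) l1 = count p l1 by apply: eq_count => x /=; rewrite negbK.
  by rewrite eq_sym -cE.
move: m2; rewrite /mixed andbC => /andP[h ->]; rewrite andbT.
by apply: etrans h; apply: eq_has => x /=; rewrite negbK.
Qed.

Lemma filter_zipcat T (p : pred T) xs bs : size xs = size bs ->
  all (all p) xs -> all (all (predC p)) bs ->
  filter p (zipcat xs bs) = flatten xs /\ filter (predC p) (zipcat xs bs) = flatten bs.
Proof.
move: xs bs; apply: seq_ind2 => //= x b xs bs sE IH /andP[px axs] /andP[pb abs].
have [E1 E2] := IH axs abs.
rewrite /zipcat /= -/(zipcat _ _) !filter_cat E1 E2 (all_filterP px) (all_filterP pb).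
rewrite (filter_all_predC pb) (filter_all_predC (p := predC p)) ?cats0 //.
by apply: sub_all px => y /=; rewrite negbK.
Qed.

(** * Index of the relation of a language without loop pairs *)

Section RelIndex.
Context (st : nat -> nat -> nat) (n : nat) (isw : pred nat) (fin : pred nat).
Context (st_le : forall q a, st q a <= n).
Notation N := n.+1.
Notation runf := (foldl st).

Definition acc w := all isw w && fin (runf 0 w).

Definition tf b : {ffun 'I_N -> 'I_N} := [ffun q : 'I_N => inord (runf q b)].

(** A run through alternating blocks in which the second blocks are known only by their action on
    states. *)
Definition blkrun (q : 'I_N) (xs : seq (seq nat)) (ts : seq {ffun 'I_N -> 'I_N}) : 'I_N :=
  foldl (fun (q : 'I_N) (t : seq nat * {ffun 'I_N -> 'I_N}) => t.2 (inord (runf q t.1))) q (zip xs ts).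

Lemma run_zipcat q xs bs : size xs = size bs -> q < N ->
  inord (runf q (zipcat xs bs)) = blkrun (inord q) xs [seq tf b | b <- bs] :> 'I_N.
Proof.
move=> sE; move: xs bs sE q; apply: seq_ind2 => //= x b xs bs _ IH q qN.
rewrite /zipcat /= -/(zipcat _ _) !foldl_cat IH; last by do 2!apply: (runf_lt st_le).
rewrite [RHS]/blkrun /= -/(blkrun _ _ _); congr (blkrun _ xs _); rewrite ffunE inordK // inordK //; exact: (runf_lt st_le).
Qed.

Definition blkkey := ('I_N * N.+1.-tuple {ffun 'I_N -> 'I_N})%type.

(* How the second component can be read in blocks once the first has been read up to [al]. *)
Definition catchkey (p : pred nat) al be : {set blkkey} :=
  [set t : blkkey | `[< exists w0 bs, [/\ size bs = N.+1, all isw w0 && all (all isw) bs,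
     all (all (predC p)) bs, filter p w0 = al /\ be = filter (predC p) w0 ++ flatten bs
     & t.1 = inord (runf 0 w0) /\ val t.2 = map tf bs] >]].

(** The future half of a run: [t] describes the past, [xs] are the [p]-blocks to be inserted between
    the blocks already fixed, and [w1] is the rest of the word. *)
Definition finish (p : pred nat) (t : blkkey) xi et :=
  exists xs w1, [/\ size xs = N.+1, all isw w1 && all (all isw) xs, all (all p) xs,
    xi = flatten xs ++ filter p w1 /\ et = filter (predC p) w1
    & fin (runf (blkrun t.1 xs t.2) w1)].

Definition relcat (p : pred nat) al xi be et := exists w,
  [/\ acc w, filter p w = al ++ xi & filter (predC p) w = be ++ et].

Lemma all_zipcat (p : pred nat) xs bs : size xs = size bs ->
  all p (zipcat xs bs) = all (all p) xs && all (all p) bs.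
Proof.
move: xs bs; apply: seq_ind2 => //= x b xs bs _ IH.
by rewrite /zipcat /= -/(zipcat _ _) !all_cat IH andbACA.
Qed.

Lemma finish_relcat p al be t xi et :
  t \in catchkey p al be -> finish p t xi et -> relcat p al xi be et.
Proof.
rewrite inE => /asboolP[w0 [bs [sb /andP[iw ib] ab [fw0 beE] [t1 t2]]]].
move=> [xs [w1 [sx /andP[iw1 ix] ax [xiE etE] fi]]].
have sE : size xs = size bs by rewrite sx sb.
have [F1 F2] := filter_zipcat sE ax ab.
exists (w0 ++ zipcat xs bs ++ w1); split.
- rewrite /acc !all_cat iw iw1 all_zipcat // ix ib /=.
  rewrite t1 t2 -run_zipcat // in fi; last exact: (runf_lt st_le).
  by move: fi; rewrite !foldl_cat inordK //; do 2!apply: (runf_lt st_le).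
- by rewrite !filter_cat fw0 F1 xiE.
- by rewrite !filter_cat F2 beE etE !catA.
Qed.

(** Here [al] is complete after [w0], and [be] only after [v]. By [catch_up], [v] splits into
    boundedly many blocks, and of those outside [p] only the actions are kept. *)
Lemma relcat_finish p al be w0 v w1 :
  ~ loop_pair st p (w0 ++ v ++ w1) -> acc (w0 ++ v ++ w1) ->
  filter p w0 = al -> filter (predC p) (w0 ++ v) = be ->
  filter p (v ++ w1) = [::] \/ size be <= size al ->
  exists2 t, t \in catchkey p al be & finish p t (filter p (v ++ w1)) (filter (predC p) w1).
Proof.
move=> nl; rewrite /acc !all_cat => /andP[/and3P[iw0 iv iw1] fi] fw0 fbe cond.
have [|xs [bs [sx sb ax ab vE]]] := catch_up st_le nl.
  case: cond => [|le]; last by right; rewrite -!size_filter fw0 fbe.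
  by rewrite filter_cat; case: (filter p v) => //; left.
have sE : size xs = size bs by rewrite sx sb.
have [F1 F2] := filter_zipcat sE ax ab.
move: iv; rewrite vE all_zipcat // => /andP[ix ib].
have tP : size (map tf bs) == N.+1 by rewrite size_map sb.
exists (inord (runf 0 w0), Tuple tP).
  rewrite inE; apply/asboolP; exists w0, bs; split=> //; first by rewrite iw0 ib.
  by split=> //; rewrite -F2 -filter_cat -vE.
exists xs, w1; split=> //; first by rewrite iw1 ix.
  by rewrite filter_cat F1.
rewrite /= -run_zipcat //; last exact: (runf_lt st_le).
rewrite inordK; first by move: fi; rewrite vE !foldl_cat.
by do 2!apply: (runf_lt st_le).
Qed.

Lemma relcat_predC p al xi be et : relcat p al xi be et <-> relcat (predC p) be et al xi.
Proof.
by split=> -[w [aw E1 E2]]; exists w; split=> //; rewrite ?filter_predC // -filter_predC.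
Qed.

(** Cut the word where it has produced [al] and where it has produced [be]. The order of the cuts
    decides which of the two keys applies; the second case is the first with the alphabets
    exchanged. *)
Lemma relcat_key p al xi be et al' be' :
  (forall w, acc w -> ~ loop_pair st p w) ->
  xi = [::] \/ size be <= size al -> et = [::] \/ size al <= size be ->
  catchkey p al be = catchkey p al' be' ->
  catchkey (predC p) be al = catchkey (predC p) be' al' ->
  relcat p al xi be et -> relcat p al' xi be' et.
Proof.
move=> nl c1 c2 K1 K2 [w [aw E1 E2]].
have [w0 [w' [wE F1 F2]]] := filter_cat_split E1.
have [v0 [v' [vE G1 G2]]] := filter_cat_split E2.
case: (leqP (size w0) (size v0)) => [le|/ltnW le].
  have [v [v0E w'E]] := cat_prefix (etrans (esym wE) vE) le.
  rewrite w'E in wE F2; rewrite v0E in G1; rewrite wE in aw.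
  rewrite -F2 in c1.
  have [t tK ft] := relcat_finish (nl _ aw) aw F1 G1 c1.
  by rewrite F2 G2 in ft; rewrite K1 in tK; apply: finish_relcat ft.
have [v [w0E v'E]] := cat_prefix (etrans (esym vE) wE) le.
rewrite v'E in vE G2; rewrite w0E -(filter_predC p) in F1; rewrite vE in aw.
rewrite -G2 in c2.
have nl' : ~ loop_pair st (predC p) (v0 ++ v ++ w').
  by move/loop_pair_predC; apply: nl.
have [t tK ft] := relcat_finish nl' aw G1 F1 c2.
rewrite G2 filter_predC F2 in ft; rewrite K2 in tK.
by apply/relcat_predC; apply: finish_relcat ft.
Qed.

(** Counts two bits and two sets of keys, a key being a state with [N.+1] maps on the [N] states. *)
Definition filter_rel_idx := (2 * 2) * (2 ^ (N * (N ^ N) ^ N.+1) * 2 ^ (N * (N ^ N) ^ N.+1)).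

Lemma idx_filter_rel K (p : pred nat) :
  (forall w, acc w -> ~ loop_pair st p w) ->
  idx K filter_rel_idx (fun a => exists w, [/\ acc w, filter p w = dec K (a 0)
                                   & filter (predC p) w = dec K (a 1)]).
Proof.
move=> nl.
exists ((bool * bool) * ({set blkkey} * {set blkkey}))%type.
exists (fun j a => ((sz K (a 0) == j, sz K (a 1) == j),
  (catchkey p (dec K (a 0)) (dec K (a 1)), catchkey (predC p) (dec K (a 1)) (dec K (a 0))))).
split.
  by rewrite !card_prod !card_bool !card_pset !card_prod card_tuple card_ffun !card_ord.
move=> j a j' a' b ba ba' [s0 s1 K1 K2].
have mixE i jj aa : bounded K jj aa -> (forall i, aa i < K.+2 ^ jj) ->
    dec K (mix K jj aa b i) = dec K (aa i) ++ (if sz K (aa i) == jj then dec K (b i) else [::]).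
  by move=> _ h; rewrite dec_mix //; case: ifP; rewrite ?cats0.
move=> [w [aw]]; rewrite !mixE // -s0 -s1 => E1 E2.
have [||w' [aw' E1' E2']] := @relcat_key p _ _ _ _ (dec K (a' 0)) (dec K (a' 1)) nl _ _ K1 K2
    (ex_intro _ w (And3 aw E1 E2)).
(* If the word of this component fills all [j] digits, it is at least as long as the other one; if
   not, padding has been read and nothing more of it follows. *)
- case: eqP => [e|]; last by left.
  by right; rewrite !size_dec e sz_lt.
- case: eqP => [e|]; last by left.
  by right; rewrite !size_dec e sz_lt.
by exists w'.
Qed.

End RelIndex.

(** * Maximal synchronous prefixes *)

Lemma in_SG_cons2 ns ng a b w :
  in_SG ns ng [:: a, b & w] = inSigma ns a && inGamma ns ng b && in_SG ns ng w.
Proof.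
rewrite /in_SG /= negbK [iota 2 _](iotaDl 2 0) all_map -!andbA.
have -> : all (preim (addn 2) (fun i => if ~~ odd i then inSigma ns (nth 0 [:: a, b & w] i)
      else inGamma ns ng (nth 0 [:: a, b & w] i))) (iota 0 (size w)) =
    all (fun i => if ~~ odd i then inSigma ns (nth 0 w i) else inGamma ns ng (nth 0 w i))
      (iota 0 (size w)).
  by apply: eq_all => i /=; rewrite negbK.
by case: (~~ odd _); rewrite /= ?andbF.
Qed.

Lemma in_SG_pairs ns ng w : in_SG ns ng w ->
  exists xs ys, [/\ size xs = size ys, w = flatten [seq [:: t.1; t.2] | t <- zip xs ys],
    all (inSigma ns) xs & all (inGamma ns ng) ys].
Proof.
elim: {w}(size w) {-2}w (leqnn (size w)) => [|k IH] [|a [|b w]] //=.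
- by move=> _ _; exists [::], [::].
- by move=> _ _; exists [::], [::].
rewrite in_SG_cons2 => sw /andP[/andP[Sa Gb]] /IH[]; first by lia.
move=> xs [ys [sE -> axs ays]]; exists (a :: xs), (b :: ys).
by rewrite /= sE Sa Gb.
Qed.

Lemma in_SG_cat ns ng u v : in_SG ns ng u -> in_SG ns ng (u ++ v) = in_SG ns ng v.
Proof.
elim: {u}(size u) {-2}u (leqnn (size u)) => [|k IH] [|a [|b u]] //= su.
by rewrite !in_SG_cons2 => /andP[-> /IH->] //; lia.
Qed.

Lemma in_SG_catl ns ng u v : ~~ odd (size u) -> in_SG ns ng (u ++ v) -> in_SG ns ng u.
Proof.
elim: {u}(size u) {-2}u (leqnn (size u)) => [|k IH] [|a [|b u]] //= su.
by rewrite negbK !in_SG_cons2 => ou /andP[-> /IH->] //; lia.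
Qed.

Lemma in_SG_even ns ng u : in_SG ns ng u -> ~~ odd (size u).
Proof. by case/andP. Qed.

Lemma in_SG_word ns ng u : in_SG ns ng u -> is_word ns ng u.
Proof.
move=> /in_SG_pairs[xs [ys [sE -> ax ay]]].
move: xs ys sE ax ay; apply: seq_ind2 => //= a b xs ys _ IH.
rewrite /inSigma /inGamma => /andP[ha hx] /andP[/andP[_ hb] hy].
by rewrite hb ltn_addr //= IH.
Qed.

(** * Synchronous prefixes as predicates on numbers *)

Section Prefixes.
Context (ns ng : nat) (AS AT : dfa).
Notation K := (ns + ng).
Notation c := K.+2.

(* The trailing [Sigma]-letter forces the decomposition of the word in [U Sigma^* Gamma^*]
   to have [z] as its first component. *)
Definition core z := in_SG ns ng z && (run AT (z ++ nseq (0 < ns) 0) \in final AT).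

Definition interleave T x y := flatten [seq [:: letter K x i; letter K y i] | i <- iota 0 T].

(** The length [T] is passed as [c ^ T], whose only nonzero digit is at place [T]; so the end of the
    prefix is visible when the three numbers are read in parallel. *)
Definition max_core t x y := exists T,
  [/\ t = c ^ T, core (interleave T x y) & ~~ core (interleave T.+1 x y)].

Lemma size_interleave T x y : size (interleave T x y) = T.*2.
Proof.
rewrite /interleave; elim: T 0 => //= T IH k.
by rewrite IH doubleS.
Qed.

Lemma interleaveD j T x0 y0 x y : x0 < c ^ j -> y0 < c ^ j ->
  interleave (j + T) (x0 + c ^ j * x) (y0 + c ^ j * y) = interleave j x0 y0 ++ interleave T x y.
Proof.
move=> xj yj; rewrite /interleave iotaD map_cat flatten_cat; congr (flatten _ ++ flatten _).
  apply/eq_in_map => i; rewrite mem_iota /= => ij.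
  by rewrite /letter !dig_mix // ij.
rewrite add0n -[j in iota j]addn0 iotaDl -map_comp; apply/eq_map => i /=.
by rewrite /letter !dig_mix // ltnNge leq_addr /= addKn.
Qed.

Lemma interleave_small j T x0 y0 x y : x0 < c ^ j -> y0 < c ^ j -> T <= j ->
  interleave T (x0 + c ^ j * x) (y0 + c ^ j * y) = interleave T x0 y0.
Proof.
move=> xj yj Tj; congr flatten; apply/eq_in_map => i; rewrite mem_iota /= => iT.
by rewrite /letter !dig_mix // (leq_trans iT Tj).
Qed.

(** Alternation is tested pair by pair, so it splits over a concatenation whose first part has even
    length; apart from that only the state reached matters. *)
Lemma core_cat z0 z0' z : ~~ odd (size z0) -> ~~ odd (size z0') ->
  in_SG ns ng z0 = in_SG ns ng z0' -> run AT z0 = run AT z0' ->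
  core (z0 ++ z) = core (z0' ++ z).
Proof.
move=> o0 o0' sg rE; rewrite /core.
have -> : in_SG ns ng (z0 ++ z) = in_SG ns ng (z0' ++ z).
  case h: (in_SG ns ng z0); first by rewrite !in_SG_cat // -sg.
  by rewrite (contraFF (in_SG_catl o0) h) (contraFF (in_SG_catl o0')) // -sg.
by congr andb; rewrite /run -!catA !(foldl_cat _ 0) -/(run AT z0) -/(run AT z0') rE.
Qed.

Lemma max_core_small j t x0 y0 x y : x0 < c ^ j -> y0 < c ^ j -> t < c ^ j ->
  max_core t (x0 + c ^ j * x) (y0 + c ^ j * y) <-> max_core t x0 y0.
Proof.
move=> xj yj tj; split=> -[T [tE ok1 ok2]]; exists T; move: tj; rewrite tE ltn_exp2l // => Tj.
  by move: ok1 ok2; rewrite !interleave_small // ltnW.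
by rewrite !interleave_small // ltnW.
Qed.

(** While the digits of [t] read so far are 0, the prefix extends at least to place [j], and it
    suffices to know the state and whether the first [j] pairs alternate. Once a nonzero digit has
    occurred, the low digits have settled the matter and the rest of [t] must be 0. *)
Lemma idx_max_core n : (forall q a, step AT q a <= n) ->
  idx K (2 * 2 * (n.+1 * 2)) (fun a => max_core (a 0) (a 1) (a 2)).
Proof.
move=> st_le; exists ((bool * bool) * ('I_n.+1 * bool))%type.
exists (fun j a => ((a 0 == 0, in_SG ns ng (interleave j (a 1) (a 2))),
   (inord (run AT (interleave j (a 1) (a 2))), `[< max_core (a 0) (a 1) (a 2) >]))); split.
  by rewrite !card_prod !card_bool card_ord.
move=> j a j' a' b ba ba' [t0 sg rE mE].
have runn w : run AT w < n.+1 by apply: (runf_lt st_le).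
have {}rE : run AT (interleave j (a 1) (a 2)) = run AT (interleave j' (a' 1) (a' 2)).
  by move/(congr1 val): rE; rewrite /= !inordK.
have key0 jj aa : bounded K jj aa -> aa 0 != 0 ->
    max_core (mix K jj aa b 0) (mix K jj aa b 1) (mix K jj aa b 2) <->
    b 0 = 0 /\ max_core (aa 0) (aa 1) (aa 2).
  move=> bb nz; rewrite /mix; split=> [H|[-> H]]; last first.
    by rewrite muln0 addn0; apply/max_core_small.
  (* A power of [c] has a single nonzero digit: if [T < jj] nothing is left above, and otherwise
     [c ^ jj] would divide the nonzero low part. *)
  have b0 : b 0 = 0.
    case: H => T [tE _ _]; case: (ltnP T jj) => Tj.
      have : c ^ T < c ^ jj by rewrite ltn_exp2l.
      by rewrite -tE; case: (b 0) => // k; rewrite mulnS; lia.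
    have : c ^ jj %| aa 0.
      by rewrite -(dvdn_addl (n := c ^ jj * b 0)) ?dvdn_mulr // tE dvdn_exp2l.
    by rewrite /dvdn modn_small ?(negbTE nz).
  by split=> //; apply/(max_core_small (b 1) (b 2) (bb 1) (bb 2) (bb 0));
    move: H; rewrite b0 muln0 addn0.
case: (boolP (a 0 == 0)) t0 => [/eqP a0 /esym/eqP a'0|nz /esym/negbT nz']; last first.
  rewrite !key0 // => -[-> H]; split=> //; apply/asboolP; rewrite -mE; exact/asboolP.
rewrite /mix a0 a'0 !add0n => -[T [tE ok1 ok2]].
have jT : j <= T.
  rewrite leqNgt; apply/negP => Tj.
  have : c ^ T < c ^ j by rewrite ltn_exp2l.
  have : 0 < c ^ T by rewrite expc_gt0.
  by rewrite -tE; case: (b 0) => [|k]; rewrite ?muln0 // mulnS; lia.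
have bE : b 0 = c ^ (T - j).
  apply/eqP; rewrite -(eqn_pmul2l (expc_gt0 K j)) tE -expnD subnKC //.
exists (j' + (T - j)); rewrite expnD bE; split=> //.
  rewrite interleaveD // -(@core_cat (interleave j (a 1) (a 2))) ?size_interleave ?odd_double // -interleaveD //.
  by rewrite subnKC.
rewrite -addnS interleaveD // -(@core_cat (interleave j (a 1) (a 2))) ?size_interleave ?odd_double // -interleaveD //.
by rewrite addnS subnKC.
Qed.

Definition codes_rel x y := exists w,
  [/\ dfa_lang ns ng AS w, filter (inSigma ns) w = dec K x
    & filter (predC (inSigma ns)) w = dec K y].

Definition sync_rel t x y := codes_rel x y /\ max_core t x y.

Definition sync_idx n := filter_rel_idx n * (2 * 2 * (n.+1 * 2)).

Lemma idx_sync_rel n : (forall q a, step AT q a <= n) -> (forall q a, step AS q a <= n) ->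
  finite_shiftlag ns ng (dfa_lang ns ng AS) ->
  idx K (sync_idx n) (fun a => sync_rel (a 0) (a 1) (a 2)).
Proof.
move=> sT sS fs; apply: idx_and; last exact: idx_max_core.
have nl w : acc (step AS) (fun a => a < K) (fun q => q \in final AS) w ->
    ~ loop_pair (step AS) (inSigma ns) w.
  by move=> h; apply: no_loop_pair fs _.
exact: (idx_sub succn (idx_filter_rel sS K nl)).
Qed.

End Prefixes.

(** * Languages with finitely many residuals *)

Section Nerode.
Context (ns ng : nat).
Notation K := (ns + ng).
Notation word := (is_word ns ng).

Definition finite_residuals (L : lang) := exists (F : finType) (key : seq nat -> F),
  forall u v z, word u -> word v -> word z -> key u = key v -> L (u ++ z) -> L (v ++ z).

Lemma is_word_cat u v : word (u ++ v) = word u && word v.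
Proof. exact: all_cat. Qed.

Lemma nreg_ext L L' : (forall w, L w <-> L' w) -> finite_residuals L -> finite_residuals L'.
Proof.
move=> LL' [F [key H]]; exists F, key => u v z wu wv wz E /LL' Lu.
by apply/LL'; apply: H E Lu.
Qed.

Lemma nreg_or L1 L2 : finite_residuals L1 -> finite_residuals L2 -> finite_residuals (fun w => L1 w \/ L2 w).
Proof.
move=> [F1 [key1 H1]] [F2 [key2 H2]].
exists (F1 * F2)%type, (fun u => (key1 u, key2 u)) => u v z wu wv wz [E1 E2] [h|h].
  by left; apply: H1 E1 h.
by right; apply: H2 E2 h.
Qed.

Lemma nreg_and L1 L2 : finite_residuals L1 -> finite_residuals L2 -> finite_residuals (fun w => L1 w /\ L2 w).
Proof.
move=> [F1 [key1 H1]] [F2 [key2 H2]].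
exists (F1 * F2)%type, (fun u => (key1 u, key2 u)) => u v z wu wv wz [E1 E2] [h1 h2].
by split; [apply: H1 E1 h1 | apply: H2 E2 h2].
Qed.

Lemma nreg_all (p : pred nat) : finite_residuals (all p).
Proof. by exists bool, (all p) => u v z _ _ _ E; rewrite !all_cat E. Qed.

Lemma nreg_false : finite_residuals (fun=> False).
Proof. by exists unit, (fun=> tt). Qed.

Lemma nreg_bigU (I : eqType) (s : seq I) (L : I -> lang) : (forall i, finite_residuals (L i)) ->
  finite_residuals (fun w => exists2 i, i \in s & L i w).
Proof.
move=> H; elim: s => [|i s IH]; first by apply: nreg_ext nreg_false => w; split=> // -[].
apply: nreg_ext (nreg_or (H i) IH) => w; split.
  by case=> [h|[i' i's h]]; [exists i; rewrite ?mem_head|exists i'; rewrite // in_cons i's orbT].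
by case=> i'; rewrite in_cons => /orP[/eqP->|i's] h; [left|right; exists i'].
Qed.

(** After [u], the cut between the factors is either still to come, which [key1] controls, or
    already made, and then [S u] lists the keys of the begun second factor. *)
Lemma nreg_cat L1 L2 : finite_residuals L1 -> finite_residuals L2 ->
  finite_residuals (fun w => exists u v, [/\ w = u ++ v, L1 u & L2 v]).
Proof.
move=> [F1 [key1 H1]] [F2 [key2 H2]].
pose S u := [set f : F2 | `[< exists u1 v, [/\ u = u1 ++ v, L1 u1 & key2 v = f] >]].
exists (F1 * {set F2})%type, (fun u => (key1 u, S u)) => u v z wu wv wz [E1 E2] [a [b [E La Lb]]].
case: (leqP (size u) (size a)) => [le|/ltnW le].
  have [e [aE zE]] := cat_prefix E le.
  exists (v ++ e), b; rewrite zE catA; split=> //.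
  move: wz; rewrite zE is_word_cat => /andP[we _].
  by apply: H1 E1 _ => //; rewrite -aE.
have [e [uE bE]] := cat_prefix (esym E) le.
have : key2 e \in S u by rewrite inE; apply/asboolP; exists a, e.
rewrite E2 inE => /asboolP[a' [e' [vE La' kE]]].
exists a', (e' ++ z); rewrite vE catA; split=> //.
move: wu wv; rewrite uE vE !is_word_cat => /andP[_ we] /andP[_ we'].
by apply: H2 (esym kE) _ => //; rewrite -bE.
Qed.

Lemma nreg_quot L s : word s -> finite_residuals L -> finite_residuals (fun w => L (s ++ w)).
Proof.
move=> ws [F [key H]]; exists F, (fun u => key (s ++ u)) => u v z wu wv wz E; rewrite !catA.
by apply: H E; rewrite // is_word_cat ws.
Qed.

(** Myhill-Nerode: states are classes of [key] with a chosen representative, and a transition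
    appends a letter to the representative. *)
Lemma nreg_regular L : (forall w, L w -> word w) -> finite_residuals L -> regular ns ng L.
Proof.
move=> Lw [F [key H]].
have /choice[r Hr] : forall f : F, exists w, (exists2 u, word u & key u = f) -> word w /\ key w = f.
  move=> f; case: (pselect (exists2 u, word u & key u = f)) => [[u wu uf]|nf].
    by exists u.
  by exists [::].
(* State 0 stands for the empty word, as runs start there; state [q'.+1] stands for the
   representative of class number [q']. *)
pose st q : seq nat := if q is q'.+1 then
   (if insub q' is Some i then r (enum_val (i : 'I_#|F|)) else [::]) else [::].
pose nx u := (enum_rank (key u)).+1.
pose A := DFA (mkseq (fun q => mkseq (fun a => nx (st q ++ [:: a])) K) #|F|.+1)
   (filter (fun q => `[< L (st q) >]) (iota 0 #|F|.+1)).
have stnx u : st (nx u) = r (key u).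
  by rewrite /st /nx insubT // => h; congr r; rewrite -[RHS]enum_rankK; congr enum_val; apply: val_inj.
have nx_lt u : nx u < #|F|.+1 by rewrite ltnS; exact: ltn_ord.
have inv w : word w -> [/\ run A w < #|F|.+1, word (st (run A w)) &
    forall z, word z -> L (w ++ z) <-> L (st (run A w) ++ z)].
  elim/last_ind: w => [|w a IH] //; rewrite -cats1 is_word_cat => /andP[ww wa].
  have [lt ws Hw] := IH ww.
  have -> : run A (w ++ [:: a]) = nx (st (run A w) ++ [:: a]).
    rewrite /run foldl_cat /= -/(run A w) !nth_mkseq //.
    by move: wa; rewrite /= andbT.
  rewrite stnx; split=> //.
    by have [] := Hr (key (st (run A w) ++ [:: a])); [eexists; last reflexivity; rewrite is_word_cat ws|].
  move=> z wz; rewrite -catA Hw ?is_word_cat ?wa // catA.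
  have wsa : word (st (run A w) ++ [:: a]) by rewrite is_word_cat ws.
  have [wr kr] := Hr _ (ex_intro2 (fun u => is_true (word u)) _ _ wsa erefl).
  by split; apply: H.
have finE q : (q \in final A) = `[< L (st q) >] && (q < #|F|.+1).
  by rewrite /A /final mem_filter mem_iota.
exists A => w; rewrite /dfa_lang; split.
  move=> Lwd; have ww := Lw _ Lwd; rewrite ww /=; have [lt ws Hw] := inv w ww.
  rewrite finE lt andbT; apply/asboolP.
  by move: (Hw [::] isT); rewrite !cats0 => <-.
case/andP=> ww; rewrite finE => /andP[/asboolP Ls _].
have [lt ws Hw] := inv w ww.
by move: (Hw [::] isT); rewrite !cats0 => ->.
Qed.

(** The digits of the fixed parameters [b] are consumed along with the word. After [B] letters they
    are exhausted, so the length read matters only up to [B]. *)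
Lemma nreg_idx n P (b : env) B : (forall i, b i <= B) -> idx K n P ->
  finite_residuals (fun x => P (scons (enc K x) b)).
Proof.
move=> bB [F [key [_ H]]].
pose h (u : seq nat) := fun i => b i %% K.+2 ^ size u.
exists ('I_B.+1 * F)%type.
exists (fun u => (inord (minn (size u) B), key (size u) (scons (enc K u) (h u)))).
move=> u v z wu wv wz [/(congr1 val)/=]; rewrite !inordK ?ltnS ?geq_minr // => sE kE.
have mE w : word w -> scons (enc K (w ++ z)) b =
    mix K (size w) (scons (enc K w) (h w)) (scons (enc K z) (fun i => b i %/ K.+2 ^ size w)).
  move=> ww; rewrite enc_cat -scons_mix; congr scons; apply: funext => i.
  by rewrite /mix /h addnC mulnC -divn_eq.
have bd w : word w -> bounded K (size w) (scons (enc K w) (h w)).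
  move=> ww; apply: bounded_scons; first exact: enc_lt.
  by move=> i; rewrite ltn_mod expc_gt0.
rewrite !mE //.
suff -> : (fun i => b i %/ K.+2 ^ size u) = (fun i => b i %/ K.+2 ^ size v).
  by apply: H kE; apply: bd.
apply: funext => i.
have small w : B <= size w -> b i %/ K.+2 ^ size w = 0.
  move=> Bw; apply: divn_small; apply: leq_ltn_trans (bB i) _.
  by apply: leq_ltn_trans Bw _; apply: ltn_expc.
case: (leqP B (size u)) => Bu; last by have -> : size u = size v by lia.
by rewrite !small //; lia.
Qed.

End Nerode.

(** * The criterion *)

Lemma mem_leq_code_seq s x : x \in s -> x <= code_seq s.
Proof.
elim: s => //= y s IH; rewrite in_cons /cpair => /orP[/eqP->|/IH]; last by lia.
apply: leqW; apply: leq_trans (leq_addr _ _); rewrite leq_divRL //.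
set z := code_seq s; case: y => [|y]; first by rewrite mul0n.
by rewrite leq_mul //; lia.
Qed.

(** Entries of a coded list are at most its code, and lookups out of range give 0; so the input
    itself bounds all states. *)
Lemma step_le A q a : step A q a <= code_dfa A.
Proof.
have nthl s i : nth 0 s i <= code_seq s.
  by case: (ltnP i (size s)) => h; [apply/mem_leq_code_seq/mem_nth | rewrite nth_default].
rewrite /step; apply: leq_trans (nthl _ _) _.
apply: leq_trans (_ : code_seq (map code_seq (delta A)) <= _); last first.
  by apply: mem_leq_code_seq; rewrite mem_head.
apply: leq_trans (nthl _ q); case: (ltnP q (size (delta A))) => h.
  by rewrite (nth_map [::]).
by rewrite !nth_default ?size_map.
Qed.

Lemma finite_representatives (F : finType) (key : nat -> F) :
  exists l, forall u, exists2 u', u' <= l & key u' = key u.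
Proof.
have /choice[r Hr] : forall f, exists x, (exists u, key u = f) -> key x = f.
  by move=> f; case: (pselect (exists u, key u = f)) => [[u uf]|nf]; [exists u|exists 0].
exists (\max_(f : F) r f) => u; exists (r (key u)); first exact: (leq_bigmax (key u)).
by apply: Hr; exists u.
Qed.

Lemma drop_take_cat (T : Type) s t (d : seq T) : s <= t <= size d ->
  drop s d = drop s (take t d) ++ drop t d.
Proof.
case/andP=> st td; rewrite -{1}(cat_take_drop t d) drop_cat size_takel //.
case: ltngtP st => // -> _.
by rewrite (@drop_oversize _ t (take t d)) ?size_takel // subnn drop0.
Qed.

Section Criterion.
Context (ns ng : nat) (AS AT : dfa).
Notation K := (ns + ng).
Notation c := K.+2.
Notation okU := (core ns ng AT).
Notation zipd := (interleave ns ng).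
Notation E := (sync_rel ns ng AS AT).

(* [E t] has finitely many left sections, represented by numbers up to [l]; the first
   conjunct says that [U] contains the empty word unless [S] is empty. *)
Definition criterion :=
  (okU [::] \/ ~ exists w, dfa_lang ns ng AS w) /\
  forall t, exists l, forall u, exists u', u' <= l /\ forall v, E t u v <-> E t u' v.

Lemma in_SG_interleave T x y : in_SG ns ng (zipd T x y) =
  all (fun i => inSigma ns (letter K x i) && inGamma ns ng (letter K y i)) (iota 0 T).
Proof.
rewrite /zipd; elim: (iota 0 T) => //= i s IH.
by rewrite in_SG_cons2 IH.
Qed.

(** The letter read at the end of a word is [K.+1], which belongs to neither alphabet. *)
Lemma in_SG_interleave_sz T x y : in_SG ns ng (zipd T x y) -> T <= sz K x /\ T <= sz K y.
Proof.
rewrite in_SG_interleave => /allP H; split; rewrite leqNgt; apply/negP => h.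
  have := H (sz K x); rewrite mem_iota /= add0n h /letter dig_sz /inSigma => /(_ isT); lia.
have := H (sz K y); rewrite mem_iota /= add0n h /letter dig_sz /inGamma => /(_ isT); lia.
Qed.

Definition pairs (xs ys : seq nat) := flatten [seq [:: t.1; t.2] | t <- zip xs ys].

Lemma interleaveE T x y : zipd T x y = pairs (pre K T x) (pre K T y).
Proof. by rewrite /zipd /pairs /pre /mkseq; elim: (iota 0 T) => //= i s ->. Qed.

Lemma pairs_prefix xs ys x y x1 y1 : size xs = size ys ->
  dec K x = xs ++ x1 -> dec K y = ys ++ y1 -> pairs xs ys = zipd (size xs) x y.
Proof.
move=> sE xE yE; rewrite interleaveE -!take_dec -?size_dec ?xE ?yE ?size_cat ?sE ?leq_addr //.
by rewrite -{1}sE !take_size_cat.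
Qed.

Lemma sem_pairs xs ys x y : size xs = size ys ->
  all (inSigma ns) (xs ++ x) -> all (inGamma ns ng) (ys ++ y) ->
  let w := pairs xs ys ++ x ++ y in
  [/\ is_word ns ng w, filter (inSigma ns) w = xs ++ x & filter (inGamma ns ng) w = ys ++ y].
Proof.
rewrite /= /pairs; move: xs ys; apply: seq_ind2 => /= [ax ay|a b xs ys _ IH].
  rewrite !filter_cat (all_filterP ax) (all_filterP ay); split.
  - rewrite /is_word all_cat; apply/andP; split.
      by apply: sub_all ax => i; rewrite /inSigma; lia.
    by apply: sub_all ay => i; rewrite /inGamma; lia.
  - rewrite (_ : filter _ y = [::]) ?cats0 //; apply/eqP; rewrite -[_ == _]negbK -has_filter.
    by rewrite -all_predC; apply: sub_all ay => i; rewrite /inGamma /inSigma /=; lia.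
  - rewrite (_ : filter _ x = [::]) //; apply/eqP; rewrite -[_ == _]negbK -has_filter.
    by rewrite -all_predC; apply: sub_all ax => i; rewrite /inGamma /inSigma /=; lia.
move=> /andP[Sa ax] /andP[Gb ay]; have [I1 I2 I3] := IH ax ay.
have [ha [hb hc]] : a < ns + ng /\ b < ns + ng /\ (inGamma ns ng a || inSigma ns b) = false.
  by move: Sa Gb; rewrite /inSigma /inGamma; lia.
move/negbT: hc; rewrite negb_or => /andP[/negbTE ga /negbTE sb].
rewrite I2 I3 Sa Gb ga sb; split=> //.
by move: I1; rewrite /is_word /= ha hb.
Qed.

Lemma sem_predC w : is_word ns ng w ->
  sem_word ns ng w = (filter (inSigma ns) w, filter (predC (inSigma ns)) w).
Proof. by move=> h; rewrite /sem_word is_word_predC. Qed.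

Lemma codes_rel_sem x y : codes_rel ns ng AS x y <-> sem ns ng (dfa_lang ns ng AS) (dec K x, dec K y).
Proof.
split=> [[w [Sw E1 E2]]|[w [Sw]]].
  by exists w; split=> //; case/andP: (Sw) => ww _; rewrite sem_predC // E1 E2.
by case/andP: (Sw) => ww _; rewrite sem_predC // => -[E1 E2]; exists w.
Qed.

(** * From a regular sublanguage to the criterion *)

Context (U : lang).
Hypothesis U_SG : forall u, U u -> in_SG ns ng u.
Hypothesis U_closed : SG_prefix_closed ns ng U.
Hypothesis TU : forall w, dfa_lang ns ng AT w <-> U_SigStar_GamStar ns ng U w.

(** If [z] followed by a [Sigma]-letter factors as [u ++ x ++ y], then [y] is empty by the last
    letter and [x] is nonempty by parity. The part of [x] inside [z] alternates and lies over
    [Sigma], so it is empty. *)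
Lemma core_U z : okU z <-> U z.
Proof.
rewrite /core; split; last first.
  move=> Uz; have sg := U_SG Uz; rewrite sg.
  have /TU/andP[] : U_SigStar_GamStar ns ng U (z ++ nseq (0 < ns) 0).
    exists z, (nseq (0 < ns) 0), [::]; rewrite cats0; split=> //; split=> //; split=> //.
    by rewrite all_nseq /inSigma; case: ns.
  by [].
case/andP=> sg rf.
have /TU[u [x [y [wE [Uu [ax ay]]]]]] : dfa_lang ns ng AT (z ++ nseq (0 < ns) 0).
  rewrite /dfa_lang rf andbT is_word_cat in_SG_word //=.
  by rewrite /is_word all_nseq; case: (ns) => //= k; rewrite addSn.
have sgu := U_SG Uu.
case: (posnP ns) => ns0.
  have SG0 w : in_SG ns ng w -> w = [::].
    by case: w => [|a [|b w]] //; rewrite in_SG_cons2 /inSigma ns0.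
  by rewrite (SG0 _ sg) -(SG0 _ sgu).
move: wE; rewrite ns0 /=; case/lastP: y ay => [|y b] ay.
  rewrite cats0 cats1; case/lastP: x ax => [|x a] ax.
    rewrite cats0 => uE; move: (in_SG_even sgu) (in_SG_even sg).
    by rewrite -uE size_rcons /= => /negP.
  rewrite -rcons_cat => /rcons_inj[zE _]; rewrite zE in sg *.
  rewrite in_SG_cat // in sg; move: ax; rewrite all_rcons => /andP[_].
  case: x sg {zE} => [|a' [|b' x]]; rewrite ?cats0 //.
  rewrite in_SG_cons2 /inGamma => /andP[/andP[_ h1] _] /= /and3P[_ h2 _].
  by move: h1 h2; rewrite /inSigma; lia.
move: ay; rewrite all_rcons cats1 -!rcons_cat => /andP[h _] /rcons_inj[_ bE].
by move: h; rewrite -bE /inGamma; lia.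
Qed.

Lemma U_prefix u v : ~~ odd (size u) -> U (u ++ v) -> U u.
Proof.
elim: {v}(size v) {-2}v (leqnn (size v)) => [|k IH] v sv ou Uuv.
  by case: v sv Uuv => //; rewrite cats0.
have sg := U_SG Uuv; have := in_SG_even sg; rewrite size_cat oddD (negbTE ou) /=.
case/lastP: v sv Uuv sg => [|v b]; first by rewrite cats0.
case/lastP: v => [|v a]; first by [].
move=> sv; rewrite -!cats1 -!catA /= catA => Uuv sg ev.
have ov : ~~ odd (size (u ++ v)).
  by move: ev; rewrite !size_cat !oddD (negbTE ou) /= addbF.
have sguv := in_SG_catl ov sg.
apply: (IH v) => //; first by move: sv; rewrite !size_rcons; lia.
move: sg; rewrite in_SG_cat // in_SG_cons2 => /andP[/andP[Sa Gb] _].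
exact: U_closed Uuv.
Qed.

Lemma criterion_of_in_Rel : in_Rel ns ng (dfa_lang ns ng AS) (dfa_lang ns ng AT) -> criterion.
Proof.
move=> [T' [[A' HA'] [sub semE]]]; split.
  case: (pselect (exists w, dfa_lang ns ng AS w)) => [[w Sw]|]; last by right.
  left; apply/core_U.
  have /semE[w' [/sub/TU[u [x [y [_ [Uu _]]]]] _]] :
    sem ns ng (dfa_lang ns ng AS) (sem_word ns ng w) by exists w.
  exact: (@U_prefix [::] u).
(* If [t] is not a power of [c], then [E t] is empty and all its sections agree. *)
move=> t; case: (pselect (exists T, t = c ^ T)) => [[T tE]|nT]; last first.
  by exists 0 => u; exists 0; split=> // v; split=> -[_ [T [tE _ _]]]; case: nT; exists T.
have st_le := step_le A'; set n := code_dfa A' in st_le.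
(* Maximality at [T] is visible in [T.+1] digits. From place [T] on only the action on the states of
   [A'] counts; the bit ensures that an exchanged word is again over [Sigma]. *)
pose key u := (Ordinal (ltn_pmod u (expc_gt0 K T.+1)),
   (all (inSigma ns) (dec K u), tf (step A') n (drop T (dec K u)))).
have [l Hl] := finite_representatives key.
exists l => u; have [u' u'l uE] := Hl u; exists u'; split=> // v.
suff main u1 u2 : key u1 = key u2 -> E t u1 v -> E t u2 v by split; apply: main.
move=> {u u' u'l uE} [] mE aE tfE [/codes_rel_sem/semE[w [T'w wE]] mU].
have ttj : t < c ^ T.+1 by rewrite tE ltn_exp2l.
have dE x : x = x %% c ^ T.+1 + c ^ T.+1 * (x %/ c ^ T.+1) by rewrite addnC mulnC -divn_eq.
have ml x : x %% c ^ T.+1 < c ^ T.+1 by rewrite ltn_mod expc_gt0.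
have preE S : S <= T.+1 -> pre K S u1 = pre K S u2.
  by move=> ST; rewrite (dE u1) (dE u2) !(pre_mix _ (ml _)) // mE.
have mU2 : max_core ns ng AT t u2 v.
  have mS x : max_core ns ng AT t x v <-> max_core ns ng AT t (x %% c ^ T.+1) (v %% c ^ T.+1).
    by rewrite {1}(dE x) {1}(dE v); apply: max_core_small.
  by apply/mS; rewrite -mE; apply/mS.
split=> //; apply/codes_rel_sem/semE.
have okT x : max_core ns ng AT t x v -> okU (zipd T x v) /\ ~~ okU (zipd T.+1 x v).
  by case=> T0 [tE0 h1 h2]; have /eqP := tE0; rewrite tE eqn_exp2l // => /eqP->.
have [ok1 nok1] := okT _ mU; have [ok2 _] := okT _ mU2.
have [Tu1 _] := in_SG_interleave_sz (proj1 (andP ok1)).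
have [Tu2 _] := in_SG_interleave_sz (proj1 (andP ok2)).
have [z [x [y [wE2 [Uz [ax ay]]]]]] : U_SigStar_GamStar ns ng U w by apply/TU/sub.
have [xs [ys [sE zE axs ays]]] := in_SG_pairs (U_SG Uz); rewrite -/(pairs _ _) in zE.
have [ww F1 F2] : [/\ is_word ns ng w, filter (inSigma ns) w = xs ++ x
    & filter (inGamma ns ng) w = ys ++ y].
  by rewrite wE2 zE; apply: sem_pairs; rewrite // all_cat (axs, ays).
have [D1 D2] : dec K u1 = xs ++ x /\ dec K v = ys ++ y.
  by move: wE; rewrite /sem_word F1 F2 => -[].
set s := size xs in sE.
have zs : z = zipd s u1 v by rewrite zE; apply: pairs_prefix D1 D2.
(* Otherwise the first [T.+1] pairs of [z] would lie in [U] by prefix closure, against the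
   maximality of [T]. *)
have sT : s <= T.
  rewrite leqNgt; apply/negP => Ts; case/negP: nok1; apply/core_U.
  apply: (@U_prefix _ (drop (T.+1).*2 z)); first by rewrite size_interleave odd_double.
  suff -> : zipd T.+1 u1 v = take (T.+1).*2 z by rewrite cat_take_drop.
  rewrite zs /interleave -(subnKC Ts) iotaD map_cat flatten_cat take_size_cat //.
  by rewrite -/(interleave ns ng T.+1 u1 v) size_interleave.
have xsE : xs = take s (dec K u2).
  rewrite take_dec ?(leq_trans sT) // -preE ?(leq_trans sT) // -take_dec ?(leq_trans sT) //.
  by rewrite D1 take_size_cat.
have xE : x = drop s (take T (dec K u1)) ++ drop T (dec K u1).
  by rewrite -drop_take_cat ?size_dec ?sT // D1 drop_size_cat.
(* Since [s <= T], the letters of [u1] from place [T] on form an unbroken factor of [w], which is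
   exchanged for one with the same action. *)
pose x' := drop s (take T (dec K u2)) ++ drop T (dec K u2).
have x'E : dec K u2 = xs ++ x'.
  by rewrite /x' -drop_take_cat ?size_dec ?sT // [in RHS]xsE cat_take_drop.
have tkE : take T (dec K u1) = take T (dec K u2) by rewrite !take_dec // preE.
have [ww' G1 G2] : let w' := pairs xs ys ++ x' ++ y in
   [/\ is_word ns ng w', filter (inSigma ns) w' = dec K u2 & filter (inGamma ns ng) w' = dec K v].
  rewrite x'E D2; apply: sem_pairs => //; last by rewrite all_cat ays.
  by rewrite -x'E -aE D1 all_cat axs.
exists (pairs xs ys ++ x' ++ y); rewrite /sem_word G1 G2; split=> //.
apply/HA'; rewrite /dfa_lang ww' /=.
move/HA': T'w; rewrite /dfa_lang ww /= wE2 zE xE /x' tkE.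
suff -> : run A' (pairs xs ys ++ (drop s (take T (dec K u2)) ++ drop T (dec K u1)) ++ y) =
  run A' (pairs xs ys ++ (drop s (take T (dec K u2)) ++ drop T (dec K u2)) ++ y) by [].
set P := pairs xs ys; set D := drop s _.
have runE D' : run A' (P ++ (D ++ D') ++ y) =
    foldl (step A') (foldl (step A') (run A' (P ++ D)) D') y by rewrite /run !foldl_cat.
rewrite !runE; set q := run A' _; congr (foldl _ _ y).
have qn : q < n.+1 by apply: runf_lt.
move/ffunP/(_ (inord q)): tfE; rewrite !ffunE inordK // => /(congr1 val) /=.
by rewrite !inordK //; apply: (runf_lt st_le).
Qed.

End Criterion.

(** * From the criterion to a regular sublanguage *)

Section Converse.
Context (ns ng : nat) (AS AT : dfa).
Notation K := (ns + ng).
Notation c := K.+2.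
Notation okU := (core ns ng AT).
Notation zipd := (interleave ns ng).
Notation E := (sync_rel ns ng AS AT).
Notation word := (is_word ns ng).
Notation fS := (filter (inSigma ns)).
Notation fG := (filter (predC (inSigma ns))).

Context (n : nat) (idxE : idx K n (fun a => E (a 0) (a 1) (a 2))).

(** For alternating [z], this choice of [t] demands that [z] be exactly the maximal synchronous
    prefix of the completed pair. *)
Definition residual z x y := E (c ^ size (fS z)) (enc K (fS z ++ x)) (enc K (fG z ++ y)).

Definition same_residual z z' := forall x y, residual z x y <-> residual z' x y.

Lemma SG_sizes z : in_SG ns ng z -> size (fG z) = size (fS z).
Proof.
move=> /in_SG_pairs[xs [ys [sE -> ax ay]]].
move: xs ys sE ax ay; apply: seq_ind2 => //= a b xs ys _ IH /andP[-> ax] /andP[Gb ay].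
have -> : inSigma ns b = false by move: Gb; rewrite /inSigma /inGamma; lia.
by rewrite /= IH.
Qed.

Lemma residual_key : exists (F : finType) (key : seq nat -> F),
  forall z z' s, in_SG ns ng z -> in_SG ns ng z' -> key z = key z' ->
    same_residual (z ++ s) (z' ++ s).
Proof.
case: idxE => F [key [_ H]].
(* The power [c ^ (size (fS z) + size (fS s))] has only zeros in its first [size (fS z)] places,
   hence the low part 0 for [t]. *)
pose a z := scons 0 (scons (enc K (fS z)) (scons (enc K (fG z)) (fun=> 0))).
exists F, (fun z => key (size (fS z)) (a z)).
suff main z z' s x y : in_SG ns ng z -> in_SG ns ng z' ->
    key (size (fS z)) (a z) = key (size (fS z')) (a z') ->
    residual (z ++ s) x y -> residual (z' ++ s) x y.
  by move=> z z' s sz sz' e x y; split; apply: main.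
move=> sz sz' e.
pose b := scons (c ^ size (fS s)) (scons (enc K (fS s ++ x)) (scons (enc K (fG s ++ y)) (fun=> 0))).
have rE w : in_SG ns ng w -> residual (w ++ s) x y <->
    E (mix K (size (fS w)) (a w) b 0) (mix K (size (fS w)) (a w) b 1) (mix K (size (fS w)) (a w) b 2).
  move=> sw; rewrite /residual !filter_cat -!catA !(enc_cat _ (fS w), enc_cat _ (fG w)).
  by rewrite size_cat expnD (SG_sizes sw).
have bd w : in_SG ns ng w -> bounded K (size (fS w)) (a w).
  move=> sw; apply: bounded_scons; first exact: expc_gt0.
  apply: bounded_scons; first exact: enc_lt.
  apply: bounded_scons; first by rewrite -(SG_sizes sw) enc_lt.
  by move=> i; apply: expc_gt0.
by rewrite !rE //; apply: H => //; apply: bd.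
Qed.

Lemma nreg_residual z0 : finite_residuals ns ng (fun z => in_SG ns ng z /\ same_residual z z0).
Proof.
have [F [key H]] := residual_key.
(* A word is split into a part of even length, to which [key] applies, and at most one pending
   letter. *)
pose ev (u : seq nat) := take (size u - odd (size u)) u.
pose od (u : seq nat) := drop (size u - odd (size u)) u.
have ole (u : seq nat) : odd (size u) <= size u by case: u => //= a l; case: (~~ _).
have sod u : size (od u) = odd (size u) by rewrite size_drop subKn.
have oev u : ~~ odd (size (ev u)).
  by rewrite size_takel ?leq_subr // oddB // oddb addbb.
exists ((bool * bool) * ('I_K.+1 * F))%type.
exists (fun u => ((odd (size u), in_SG ns ng (ev u)), (inord (head 0 (od u)), key (ev u)))).
move=> u v z wu wv wz [oE sg /(congr1 val) hE kE].
have odE : od u = od v.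
  have hw w : word w -> head 0 (od w) < K.+1.
    move=> ww; have : word (od w) by apply/allP => i /mem_drop; apply: (allP ww).
    by case: (od w) => //= a l /andP[h _]; rewrite ltnS ltnW.
  move: hE; rewrite /= !inordK ?hw //.
  have := sod u; have := sod v; rewrite oE.
  by case: (od u) (od v) => [|a [|? ?]] [|b [|? ?]] //=; case: odd => //= _ _ ->.
have uE w : w = ev w ++ od w by rewrite cat_take_drop.
rewrite (uE u) (uE v) -odE -!catA => -[sgu sr].
have sgeu : in_SG ns ng (ev u) by apply: in_SG_catl sgu.
have sgev : in_SG ns ng (ev v) by rewrite -sg.
split; first by rewrite (in_SG_cat _ sgeu) in sgu; rewrite (in_SG_cat _ sgev).
move=> x y; apply: iff_trans (sr x y); apply: iff_sym; exact: H.
Qed.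

(** The continuations of [z] whose section is that of [r]; [Ylang] is this section. As [r] runs
    through representatives of all sections, their products exhaust the residual of [z]. *)
Definition Xlang z r : lang := fun x => all (inSigma ns) x /\
  forall v, E (c ^ size (fS z)) (enc K (fS z ++ x)) v <-> E (c ^ size (fS z)) r v.

Definition Ylang z r : lang := fun y => all (inGamma ns ng) y /\
  E (c ^ size (fS z)) r (enc K (fG z ++ y)).

Lemma word_filter (p : pred nat) z : word z -> word (filter p z).
Proof. by move=> wz; apply/allP => i; rewrite mem_filter => /andP[_]; apply: (allP wz). Qed.

Lemma nreg_X z r : word z -> finite_residuals ns ng (Xlang z r).
Proof.
move=> wz; apply: nreg_and (nreg_all _ _ _) _.
pose b := scons (c ^ size (fS z)) (scons r (fun=> 0)).
pose P (a : env) := forall v, E (a 1) (a 0) v <-> E (a 1) (a 2) v.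
apply: (nreg_quot (L := fun w => P (scons (enc K w) b))); first exact: word_filter.
apply: (@nreg_idx _ _ (2 ^ (n * n)) P b (c ^ size (fS z) + r)).
  by case=> [|[|i]] //=; lia.
(* The bound [v] is variable 0, which moves the word, [t] and [r] to 1, 2 and 3. *)
pose f1 i := if i is 0 then 2 else if i is 1 then 1 else 0.
pose f2 i := if i is 0 then 2 else if i is 1 then 3 else 0.
exact: (idx_all (idx_iff (idx_sub f1 idxE) (idx_sub f2 idxE))).
Qed.

Lemma nreg_Y z r : word z -> finite_residuals ns ng (Ylang z r).
Proof.
move=> wz; apply: nreg_and (nreg_all _ _ _) _.
pose b := scons (c ^ size (fS z)) (scons r (fun=> 0)).
pose P (a : env) := E (a 1) (a 2) (a 0).
apply: (nreg_quot (L := fun w => P (scons (enc K w) b))); first exact: word_filter.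
apply: (@nreg_idx _ _ n P b (c ^ size (fS z) + r)).
  by case=> [|[|i]] //=; lia.
pose f i := if i is 0 then 1 else if i is 1 then 2 else 0.
exact: (idx_sub f idxE).
Qed.

Context (U : lang).
Hypothesis U_SG : forall u, U u -> in_SG ns ng u.
Hypothesis TU : forall w, dfa_lang ns ng AT w <-> U_SigStar_GamStar ns ng U w.

Lemma in_Rel_of_criterion : criterion ns ng AS AT ->
  in_Rel ns ng (dfa_lang ns ng AS) (dfa_lang ns ng AT).
Proof.
move=> [ok0 /choice[l Hl]].
have [F [key Hkey]] := residual_key.
(* Each key attained by an alternating word gets such a word as representative; any other key gets
   the empty word. *)
have /choice[rep Hrep] : forall k, exists z, in_SG ns ng z /\
    ((exists2 z', in_SG ns ng z' & key z' = k) -> key z = k).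
  move=> k; case: (pselect (exists2 z', in_SG ns ng z' & key z' = k)) => [[z sz e]|nz].
    by exists z.
  by exists [::].
have wrep k : word (rep k) by apply/in_SG_word/(proj1 (Hrep k)).
pose t k := c ^ size (fS (rep k)).
(* [z] ranges over all alternating words with the residual of [rep k]; the representative only names
   the languages of continuations. *)
pose piece k r : lang := fun w => exists z v,
  [/\ w = z ++ v, in_SG ns ng z /\ same_residual z (rep k)
    & exists x y, [/\ v = x ++ y, Xlang (rep k) r x & Ylang (rep k) r y]].
pose T' : lang := fun w => exists2 k, k \in enum F & exists2 r, r \in iota 0 (l (t k)).+1 & piece k r w.
have T'E w : T' w -> exists z x y, [/\ w = z ++ x ++ y, in_SG ns ng z,
    all (inSigma ns) x, all (inGamma ns ng) y & residual z x y].
  case=> k _ [r _ [z [v [-> [sz sr] [x [y [-> [ax HX] [ay HY]]]]]]]].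
  by exists z, x, y; split=> //; apply/sr/HX.
have semT z x y : in_SG ns ng z -> all (inSigma ns) x -> all (inGamma ns ng) y ->
    [/\ word (z ++ x ++ y), fS (z ++ x ++ y) = fS z ++ x & fG (z ++ x ++ y) = fG z ++ y].
  move=> /in_SG_pairs[xs [ys [sE -> axs ays]]] ax ay.
  have [||ww F1 F2] := @sem_pairs ns ng xs ys x y sE; rewrite ?all_cat ?axs ?ays //.
  have [||w0 G1 G2] := @sem_pairs ns ng xs ys [::] [::] sE; rewrite ?all_cat ?axs ?ays //.
  rewrite !cats0 in w0 G1 G2; rewrite -/(pairs xs ys) ww F1 G1.
  by rewrite -(is_word_predC ww) F2 -(is_word_predC w0) G2.
have wT' w : T' w -> word w.
  by case/T'E => z [x [y [-> sz ax ay _]]]; case: (semT z x y).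
exists T'; split.
  apply: nreg_regular => //; apply: nreg_bigU => k; apply: nreg_bigU => r.
  by apply: nreg_cat (nreg_residual _) (nreg_cat (nreg_X r (wrep k)) (nreg_Y r (wrep k))).
(* The residual carries both facts: [z] is a core prefix, which puts the word into [T], and the pair
   belongs to the relation of [S]. *)
have T'S w : T' w -> dfa_lang ns ng AT w /\ sem ns ng (dfa_lang ns ng AS) (fS w, fG w).
  case/T'E => z [x [y [wE sz ax ay [/codes_rel_sem rS [T [tE okz _]]]]]].
  have [ww F1 F2] := semT _ _ _ sz ax ay; rewrite -wE in ww F1 F2.
  have wd p s : is_true (word (filter p z)) -> is_true (word s) -> dec K (enc K (filter p z ++ s)) = filter p z ++ s.
    by move=> h1 h2; rewrite encK // -[all _ _]/(word _) is_word_cat h1.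
  have wz : word z by apply: in_SG_word sz.
  have wx : word x by apply: sub_all ax => i; rewrite /inSigma; lia.
  have wy : word y by apply: sub_all ay => i; rewrite /inGamma; lia.
  have eS := wd _ _ (word_filter (inSigma ns) wz) wx.
  have eG := wd _ _ (word_filter (predC (inSigma ns)) wz) wy.
  split; last by rewrite F1 F2; move: rS; rewrite eS eG.
  apply/TU; exists z, x, y; split=> //; split=> //; apply/(core_U U_SG TU).
  have /eqP := tE; rewrite eqn_exp2l // => /eqP TE; rewrite -TE in okz.
  have [xs [ys [sE zE axs ays]]] := in_SG_pairs sz; rewrite -/(pairs _ _) in zE.
  have [||w0 G1 G2] := @sem_pairs ns ng xs ys [::] [::] sE; rewrite ?cats0 //.
  rewrite !cats0 -zE in w0 G1 G2; rewrite is_word_predC // in G2.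
  suff -> : z = zipd (size (fS z)) (enc K (fS z ++ x)) (enc K (fG z ++ y)) by [].
  rewrite G1 in eS *; rewrite G2 in eG *.
  by rewrite {1}zE; apply: pairs_prefix eS eG.
split; first by move=> w /T'S[].
move=> p; split.
  case=> w [T'w <-]; rewrite sem_predC ?wT' //.
  by case/T'S: T'w.
case=> w0 [Sw0 <-]; have w0w : word w0 by case/andP: Sw0.
rewrite sem_predC //.
set X := fS w0; set Y := fG w0.
have wX : word X by apply: word_filter.
have wY : word Y by apply: word_filter.
have dX : dec K (enc K X) = X by apply: encK.
have dY : dec K (enc K Y) = Y by apply: encK.
(* At [T = size X] the next pair lies past the end of [X], so a least failing [T] exists. The prefix
   of [T] pairs is then in [U]; for [T = 0] this is the first part of the criterion. *)
have ex : exists T, ~~ okU (zipd T.+1 (enc K X) (enc K Y)).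
  exists (size X); apply/negP=> /andP[/in_SG_interleave_sz[]].
  by rewrite -size_dec dX ltnn.
case: (ex_minnP ex) => T nokT minT.
have okT : okU (zipd T (enc K X) (enc K Y)).
  case: T minT {nokT} => [_|T minT]; first by case: ok0 => // -[]; exists w0.
  by apply: contraT => /minT; rewrite ltnn.
have sgz := proj1 (andP okT); set z := zipd _ _ _ in okT sgz.
have [] := in_SG_interleave_sz sgz; rewrite -!size_dec dX dY => TX TY.
have zE : z = pairs (take T X) (take T Y).
  by rewrite /z interleaveE -!take_dec -?size_dec ?dX ?dY.
have aX : all (inSigma ns) X by apply: filter_all.
have aY : all (inGamma ns ng) Y by rewrite /Y -(is_word_predC w0w); apply: filter_all.
have sE : size (take T X) = size (take T Y) by rewrite !size_takel.
have aTX : all (inSigma ns) (take T X) by apply/allP => i /mem_take; apply: (allP aX).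
have aTY : all (inGamma ns ng) (take T Y) by apply/allP => i /mem_take; apply: (allP aY).
have aDX : all (inSigma ns) (drop T X) by apply/allP => i /mem_drop; apply: (allP aX).
have aDY : all (inGamma ns ng) (drop T Y) by apply/allP => i /mem_drop; apply: (allP aY).
have [||wz G1 G2] := @sem_pairs ns ng _ _ [::] [::] sE; rewrite ?cats0 //.
rewrite !cats0 -zE in wz G1 G2; rewrite is_word_predC // in G2.
pose w := z ++ drop T X ++ drop T Y.
have [ww FX FY] := semT _ _ _ sgz aDX aDY; rewrite -/w in ww FX FY.
rewrite G1 cat_take_drop in FX; rewrite G2 cat_take_drop in FY.
exists w; split; last by rewrite sem_predC // FX FY.
have resz : residual z (drop T X) (drop T Y).
  rewrite /residual G1 G2 !cat_take_drop size_takel //; split.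
    by exists w0; rewrite dX dY.
  by exists T.
pose k := key z.
have [sgk kE] := Hrep k.
have zk : same_residual z (rep k).
  by have := Hkey z (rep k) [::] sgz sgk; rewrite !cats0; apply; rewrite kE //; exists z.
have [r [rl Hr]] := Hl (t k) (enc K (fS (rep k) ++ drop T X)).
exists k; first by rewrite mem_enum.
exists r; first by rewrite mem_iota ltnS.
exists z, (drop T X ++ drop T Y); split=> //.
exists (drop T X), (drop T Y); split=> //; split=> //.
by apply/Hr/zk.
Qed.

End Converse.

(** * The decision procedure *)

(** Reduces an operator to its value on variables, so that its body is analysed once for all
    arguments. *)
Lemma cf_op1 k g f : computable 1 (fun s => g (nth 0 s 0)) -> computable k f -> computable k (fun s => g (f s)).
Proof. by move=> Hg Hf; apply: (cf_comp (fs := [:: f]) Hg). Qed.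

Lemma cf_op2 k g f1 f2 : computable 2 (fun s => g (nth 0 s 0) (nth 0 s 1)) ->
  computable k f1 -> computable k f2 -> computable k (fun s => g (f1 s) (f2 s)).
Proof. by move=> Hg H1 H2; apply: (cf_comp (fs := [:: f1; f2]) Hg). Qed.

Lemma cf_op3 k g f1 f2 f3 : computable 3 (fun s => g (nth 0 s 0) (nth 0 s 1) (nth 0 s 2)) ->
  computable k f1 -> computable k f2 -> computable k f3 -> computable k (fun s => g (f1 s) (f2 s) (f3 s)).
Proof. by move=> Hg H1 H2 H3; apply: (cf_comp (fs := [:: f1; f2; f3]) Hg). Qed.

Lemma cf_op4 k g f1 f2 f3 f4 :
  computable 4 (fun s => g (nth 0 s 0) (nth 0 s 1) (nth 0 s 2) (nth 0 s 3)) ->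
  computable k f1 -> computable k f2 -> computable k f3 -> computable k f4 -> computable k (fun s => g (f1 s) (f2 s) (f3 s) (f4 s)).
Proof. by move=> Hg H1 H2 H3 H4; apply: (cf_comp (fs := [:: f1; f2; f3; f4]) Hg). Qed.

Ltac cfa := repeat  lazymatch goal with
  | |- computableb _ (fun s => @?f s <= @?g s) => apply: cp_leq
  | |- computableb _ (fun s => @?f s && @?g s) => apply: cp_and
  | |- computableb _ (fun s => @?f s || @?g s) => apply: cp_or
  | |- computableb _ (fun s => ~~ @?f s) => apply: cp_not
  | |- computableb _ (fun s => bex _ _) => apply: cp_bex
  | |- computableb _ (fun s => ball _ _) => apply: cp_ball
  | |- computable _ (fun s => bmin _ _) => apply: cf_bmin
  | |- computable _ (fun s => iteri _ _ _) => apply: cf_rec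
  | |- computable _ (fun s => if _ then _ else _) => apply: cf_if
  | |- computable _ (fun s => @?f s + @?g s) => apply: cf_add
  | |- computable _ (fun s => @?f s * @?g s) => apply: cf_mul
  | |- computable _ (fun s => @?f s - @?g s) => apply: cf_sub
  | |- computable _ (fun s => @?f s ^ @?g s) => apply: cf_exp
  | |- computable _ (fun s => @?f s %/ @?g s) => apply: cf_div
  | |- computable _ (fun s => @?f s %% @?g s) => apply: cf_mod
  | |- _ => first [leaf | exact: cf_const | exact: cp_const | apply: cp_eq | apply: cp_eqb | apply: cf_succ]
  end.

(** * Decoding Cantor pairs, lists and automata *)

Lemma tri_succ s : s.+1 * s.+2 %/ 2 = s * s.+1 %/ 2 + s.+1.
Proof.
have -> : s.+1 * s.+2 = s.+1 * 2 + s * s.+1 by lia.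
by rewrite divnMDl // addnC.
Qed.

(** The diagonals [a + b = s] of the Cantor pairing occupy disjoint intervals, which gives
    injectivity. *)
Lemma tri_lt s s' : s < s' -> s * s.+1 %/ 2 + s < s' * s'.+1 %/ 2.
Proof.
elim: s' => // s' IH; rewrite ltnS leq_eqVlt tri_succ => /orP[/eqP->|/IH]; last by lia.
by rewrite addnS.
Qed.

Lemma cpair_inj a b a' b' : cpair a b = cpair a' b' -> a = a' /\ b = b'.
Proof.
rewrite /cpair => E; case: (ltngtP (a + b) (a' + b')) => [/tri_lt|/tri_lt|sE]; [lia|lia|].
by move: E; rewrite sE; lia.
Qed.

Lemma leq_cpair a b : a <= cpair a b /\ b <= cpair a b.
Proof.
split; last exact: leq_addl.
have := @mem_leq_code_seq [:: a]; rewrite /cpair.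
case: (posnP (a + b)) => [|ab _]; first by lia.
have := @tri_lt (a + b).-1 (a + b); rewrite prednK // => /(_ (leqnn _)); lia.
Qed.

(** Both components lie below [z]. For 0, the code of the empty list, the range is empty and the
    result 0 agrees with the default of [nth]. *)
Definition chead z := bmin z (fun a => bex z (fun b => (cpair a b).+1 == z)).
Definition ctail z := bmin z (fun b => bex z (fun a => (cpair a b).+1 == z)).
Definition cdrop i z := iteri i (fun _ y => ctail y) z.
Definition cnth z i := chead (cdrop i z).
Definition cmem z q := bex z.+1 (fun i => (1 <= cdrop i z) && (chead (cdrop i z) == q)).
Definition stepc z q a := cnth (cnth (chead z) q) a.
Definition finc z q := cmem (chead (ctail z)) q.

Lemma chead_cons x r : chead (cpair x r).+1 = x.
Proof.
have [lx lr] := leq_cpair x r; apply: bmin_eq => [||i ix]; rewrite ?ltnS //.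
  by apply/bexP; exists r; rewrite ?ltnS.
by apply/bexP => -[b _ /eqP[/cpair_inj[ei _]]]; move: ix; rewrite ei ltnn.
Qed.

Lemma ctail_cons x r : ctail (cpair x r).+1 = r.
Proof.
have [lx lr] := leq_cpair x r; apply: bmin_eq => [||i ix]; rewrite ?ltnS //.
  by apply/bexP; exists x; rewrite ?ltnS.
by apply/bexP => -[b _ /eqP[/cpair_inj[_ ei]]]; move: ix; rewrite ei ltnn.
Qed.

Lemma cdrop_code i s : cdrop i (code_seq s) = code_seq (drop i s).
Proof.
rewrite /cdrop; elim: i => [|i IH]; first by rewrite drop0.
rewrite iteriS IH -add1n -drop_drop.
by case: (drop i s) => [|x r] //=; rewrite ctail_cons drop0.
Qed.

Lemma cnth_code s i : cnth (code_seq s) i = nth 0 s i.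
Proof.
rewrite /cnth cdrop_code -[in RHS](addn0 i) -nth_drop.
by case: (drop i s) => //= x r; apply: chead_cons.
Qed.

Lemma size_le_code s : size s <= code_seq s.
Proof. by elim: s => //= x s IH; have [_] := leq_cpair x (code_seq s); lia. Qed.

Lemma cmem_code s q : cmem (code_seq s) q = (q \in s).
Proof.
apply/bexP/idP => [[i _]|qs].
  rewrite cdrop_code; case E: (drop i s) => [|x r] //= /eqP; rewrite chead_cons => <-.
  by apply: (mem_drop (n0 := i)); rewrite E mem_head.
exists (index q s); first by rewrite ltnS ltnW // (leq_trans _ (size_le_code s)) // index_mem.
rewrite cdrop_code; have := @drop_nth _ 0 (index q s) s; rewrite index_mem => /(_ qs) ->.
by rewrite /= chead_cons nth_index.
Qed.

Lemma stepc_code A q a : stepc (code_dfa A) q a = step A q a.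
Proof.
rewrite /stepc chead_cons !cnth_code /step.
case: (ltnP q (size (delta A))) => h; first by rewrite (nth_map [::]) // cnth_code.
by rewrite !nth_default ?size_map // (cnth_code [::]) nth_nil.
Qed.

Lemma finc_code A q : finc (code_dfa A) q = (q \in final A).
Proof. by rewrite /finc ctail_cons chead_cons cmem_code. Qed.

Lemma cf_cpair k f g : computable k f -> computable k g -> computable k (fun s => cpair (f s) (g s)).
Proof.
move=> Hf Hg; apply: cf_add => //; apply: cf_div; last exact: cf_const.
by apply: cf_mul; [|apply: cf_succ]; apply: cf_add.
Qed.

Lemma cf_chead k f : computable k f -> computable k (fun s => chead (f s)).
Proof.
apply: cf_op1; rewrite /chead; cfa; apply: cf_cpair; cfa.
Qed.

Lemma cf_ctail k f : computable k f -> computable k (fun s => ctail (f s)).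
Proof. by apply: cf_op1; rewrite /ctail; cfa; apply: cf_cpair; cfa. Qed.

Lemma cf_cdrop k f g : computable k f -> computable k g -> computable k (fun s => cdrop (f s) (g s)).
Proof. by apply: cf_op2; rewrite /cdrop; cfa; apply: cf_ctail; cfa. Qed.

Lemma cf_cnth k f g : computable k f -> computable k g -> computable k (fun s => cnth (f s) (g s)).
Proof. by move=> Hf Hg; apply: cf_chead; apply: cf_cdrop. Qed.

Lemma cp_cmem k f g : computable k f -> computable k g -> computableb k (fun s => cmem (f s) (g s)).
Proof.
apply: (@cf_op2 k (fun x y => cmem x y)); rewrite /cmem.
change (computableb 2 (fun s => bex (nth 0 s 0).+1 (fun i => (1 <= cdrop i (nth 0 s 0)) &&
  (chead (cdrop i (nth 0 s 0)) == nth 0 s 1)))).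
by cfa; [apply: cf_cdrop | apply: cf_chead; apply: cf_cdrop]; cfa.
Qed.

Lemma cf_stepc k f g h : computable k f -> computable k g -> computable k h -> computable k (fun s => stepc (f s) (g s) (h s)).
Proof. by move=> Hf Hg Hh; do 2!apply: cf_cnth => //; apply: cf_chead. Qed.

Lemma cp_finc k f g : computable k f -> computable k g -> computableb k (fun s => finc (f s) (g s)).
Proof. by move=> Hf Hg; apply: cp_cmem => //; apply: cf_chead; apply: cf_ctail. Qed.

(** * Computable forms of the predicates in the criterion *)

Section Procedure.
Context (ns ng : nat).
Notation K := (ns + ng).
Notation c := K.+2.

Lemma cf_dig k f g : computable k f -> computable k g -> computable k (fun s => dig K (f s) (g s)).
Proof. by apply: cf_op2; rewrite /dig; cfa. Qed.

Lemma cf_letter k f g : computable k f -> computable k g -> computable k (fun s => letter K (f s) (g s)).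
Proof. by move=> Hf Hg; apply: cf_sub; [exact: cf_const | apply: cf_dig]. Qed.

Lemma cf_sz k f : computable k f -> computable k (fun s => sz K (f s)).
Proof. by apply: cf_op1; rewrite /sz; cfa; apply: cf_dig; cfa. Qed.

Definition runc z T x := iteri T (fun i q => stepc z q (letter K x i)) 0.

Lemma cf_runc k f g h : computable k f -> computable k g -> computable k h -> computable k (fun s => runc (f s) (g s) (h s)).
Proof.
apply: cf_op3; rewrite /runc; cfa.
by apply: cf_stepc; cfa; apply: cf_letter; cfa.
Qed.

Lemma foldl_pre (st : nat -> nat -> nat) q T x :
  foldl st q (pre K T x) = iteri T (fun i q => st q (letter K x i)) q.
Proof.
elim: T => // T IH; rewrite iteriS -IH /pre /mkseq -[in iota _ _]addn1 iotaD map_cat foldl_cat.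
by [].
Qed.

Definition accc z W := ball (sz K W) (fun i => (letter K W i).+1 <= K) && finc z (runc z (sz K W) W).

Lemma cp_accc k f g : computable k f -> computable k g -> computableb k (fun s => accc (f s) (g s)).
Proof.
apply: (@cf_op2 k (fun x y => accc x y)); rewrite /accc.
apply: (@cp_and 2); cfa.
- by apply: cf_letter; cfa.
- by apply: cf_sz; cfa.
- by apply: cp_finc; cfa; apply: cf_runc; cfa; apply: cf_sz; cfa.
Qed.

Lemma accc_code A W : dfa_lang ns ng A (dec K W) = accc (code_dfa A) W.
Proof.
rewrite /accc /dfa_lang finc_code; congr (is_true (_ && _)).
  by rewrite /is_word /dec /pre /mkseq all_map; apply: eq_all.
suff -> : run A (dec K W) = runc (code_dfa A) (sz K W) W by [].
rewrite /run -/(step A) foldl_pre /runc.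
by elim: (sz K W) => //= i ->; rewrite stepc_code.
Qed.

Definition encf (p : pred nat) x := iteri x (fun i y =>
  if dig K x (x - i.+1) == 0 then 0 else
  if p (letter K x (x - i.+1)) then dig K x (x - i.+1) + c * y else y) 0.

Lemma cf_encf (p : pred nat) : (forall k f, computable k f -> computableb k (fun s => p (f s))) ->
  forall k f, computable k f -> computable k (fun s => encf p (f s)).
Proof.
move=> Hp k f; apply: cf_op1; rewrite /encf; cfa.
- by apply: cf_dig; cfa.
- by apply: Hp; apply: cf_letter; cfa.
- by apply: cf_dig; cfa.
Qed.

Lemma dec0 : dec K 0 = [::].
Proof. by rewrite /dec (_ : sz K 0 = 0). Qed.

Lemma dec_div x k : dec K (x %/ c ^ k) =
  if dig K x k == 0 then [::] else letter K x k :: dec K (x %/ c ^ k.+1).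
Proof.
have E : x %/ c ^ k = dig K x k + c ^ 1 * (x %/ c ^ k.+1).
  by rewrite expn1 expnSr divnMA /dig; set y := x %/ c ^ k; rewrite addnC mulnC -divn_eq.
have lt : dig K x k < c ^ 1 by rewrite expn1 dig_lt.
rewrite E dec_mix //.
have d0 : dig K (dig K x k) 0 = dig K x k.
  by rewrite {1}/dig expn0 divn1 modn_small ?dig_lt.
case: eqP => s1; case: eqP => x0 //.
- by move: (@dig_lt_sz K (dig K x k) 0); rewrite s1 d0 x0 => /(_ isT).
- by rewrite /dec s1 /pre /mkseq /= /letter d0.
- by rewrite x0 dec0.
- case: s1; apply: sz_uniq => [|[|i] // _]; first by rewrite (dig_small lt).
  by rewrite d0; apply/eqP.
Qed.

Lemma encfE p x : encf p x = enc K (filter p (dec K x)).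
Proof.
rewrite /encf; set F := fun i y => _.
suff H i : i <= x -> iteri i F 0 = enc K (filter p (dec K (x %/ c ^ (x - i)))).
  by rewrite H // subnn expn0 divn1.
elim: i => [_|i IH ix]; first by rewrite subn0 divn_small ?ltn_expc // dec0.
rewrite iteriS IH ?(ltnW ix) // /F (dec_div x (x - i.+1)).
have -> : (x - i.+1).+1 = x - i by lia.
case: eqP => //= d0; case: ifP => //= _; congr addn.
by have := dig_lt K x (x - i.+1); rewrite /letter; lia.
Qed.

(** Several numbers decode to the same word, so canonical codes are compared. A witness has length
    at most [x + y], which bounds the search. *)
Definition relc z x y := bex (c ^ (x + y)) (fun W => accc z W &&
  (encf (inSigma ns) W == encf predT x) && (encf (predC (inSigma ns)) W == encf predT y)).

Lemma cp_relc k f g h : computable k f -> computable k g -> computable k h -> computableb k (fun s => relc (f s) (g s) (h s)).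
Proof.
have HS k' f' : computable k' f' -> computableb k' (fun s => inSigma ns (f' s)).
  by move=> Hf; rewrite /inSigma; cfa.
have HT k' (f' : seq nat -> nat) : computable k' f' -> computableb k' (fun s => predT (f' s)).
  by move=> _; apply: cp_const.
have HC k' f' : computable k' f' -> computableb k' (fun s => predC (inSigma ns) (f' s)).
  by move=> Hf; apply: cp_not; apply: HS.
apply: (@cf_op3 k (fun x y z => relc x y z)); rewrite /relc.
apply: (@cp_bex 3); last by cfa.
apply: cp_and; first apply: cp_and.
- by apply: cp_accc; cfa.
- by apply: cp_eq; [apply: (cf_encf HS) | apply: (cf_encf HT)]; cfa.
- by apply: cp_eq; [apply: (cf_encf HC) | apply: (cf_encf HT)]; cfa.
Qed.

Lemma enc_inj u v : all (leq^~ K) u -> all (leq^~ K) v -> enc K u = enc K v -> u = v.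
Proof. by move=> hu hv e; rewrite -(enc_leK hu) e enc_leK. Qed.

Lemma size_filter_predC T (p : pred T) w :
  size w = size (filter p w) + size (filter (predC p) w).
Proof. by rewrite !size_filter count_predC. Qed.

Lemma relcP A x y : reflect (codes_rel ns ng A x y) (relc (code_dfa A) x y).
Proof.
have fl p W : all (leq^~ K) (filter p (dec K W)).
  by apply/allP => i; rewrite mem_filter => /andP[_]; apply: (allP (dec_le K W)).
apply: (iffP (bexP _ _)) => [[W _ /andP[/andP[]]]|[w [Sw E1 E2]]].
  rewrite -[is_true (accc _ _)]accc_code !encfE !filter_predT => Sw /eqP E1 /eqP E2.
  by exists (dec K W); split=> //; apply: enc_inj; rewrite ?fl ?dec_le.
have wE : dec K (enc K w) = w by apply: encK; case/andP: Sw.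
exists (enc K w); last first.
  by rewrite !encfE !filter_predT wE E1 E2 !eqxx !andbT -accc_code wE.
apply: leq_trans (enc_lt _ _) _; rewrite leq_pexp2l //.
by rewrite (size_filter_predC (inSigma ns)) E1 E2 !size_dec leq_add ?sz_le.
Qed.

Definition okc z T x y := ball T (fun i => inSigma ns (letter K x i) && inGamma ns ng (letter K y i))
  && finc z (iteri (0 < ns) (fun _ q => stepc z q 0)
    (iteri T (fun i q => stepc z (stepc z q (letter K x i)) (letter K y i)) 0)).

Lemma cp_okc k f g h l : computable k f -> computable k g -> computable k h -> computable k l ->
  computableb k (fun s => okc (f s) (g s) (h s) (l s)).
Proof.
apply: (@cf_op4 k (fun x y z t => okc x y z t)); rewrite /okc /inSigma /inGamma.
apply: (@cp_and 4); cfa; try by apply: cf_letter; cfa.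
apply: cp_finc; cfa; last by apply: cf_stepc; cfa.
by apply: cf_stepc; cfa; [apply: cf_stepc; cfa|]; apply: cf_letter; cfa.
Qed.

Lemma okc_code A T x y : okc (code_dfa A) T x y = core ns ng A (interleave ns ng T x y).
Proof.
rewrite /okc /core in_SG_interleave finc_code.
suff -> : run A (interleave ns ng T x y ++ nseq (0 < ns) 0) = iteri (0 < ns)
    (fun _ q => stepc (code_dfa A) q 0) (iteri T (fun i q =>
      stepc (code_dfa A) (stepc (code_dfa A) q (letter K x i)) (letter K y i)) 0) by [].
rewrite /run -/(step A) foldl_cat.
have -> : iteri T (fun i q => stepc (code_dfa A) (stepc (code_dfa A) q (letter K x i)) (letter K y i)) 0
    = foldl (step A) 0 (interleave ns ng T x y).
  elim: T => // T IH; rewrite iteriS IH -[in RHS]addn1 /interleave iotaD map_cat flatten_cat foldl_cat.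
  by rewrite /= !stepc_code.
by case: (0 < ns) => //=; rewrite stepc_code.
Qed.

Definition maxc z t x y := bex t.+1 (fun T => (t == c ^ T) && okc z T x y && ~~ okc z T.+1 x y).

Lemma cp_maxc k f g h l : computable k f -> computable k g -> computable k h -> computable k l ->
  computableb k (fun s => maxc (f s) (g s) (h s) (l s)).
Proof.
apply: (@cf_op4 k (fun x y z t => maxc x y z t)); rewrite /maxc.
by apply: (@cp_bex 4); cfa; apply: cp_okc; cfa.
Qed.

Lemma maxcP A t x y : reflect (max_core ns ng A t x y) (maxc (code_dfa A) t x y).
Proof.
apply: (iffP (bexP _ _)) => [[T _ /andP[/andP[/eqP tE]]]|[T [tE ok nok]]].
  by rewrite !okc_code => ok nok; exists T.
exists T; last by rewrite !okc_code ok nok tE eqxx.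
by rewrite tE ltnS ltnW // ltn_expc.
Qed.

Definition Ec zS zT t x y := relc zS x y && maxc zT t x y.

Lemma EcP AS AT t x y : reflect (sync_rel ns ng AS AT t x y) (Ec (code_dfa AS) (code_dfa AT) t x y).
Proof. by apply: (iffP andP) => -[/relcP h1 /maxcP h2]. Qed.

Lemma cp_Ec k f g h l m : computable k f -> computable k g -> computable k h -> computable k l -> computable k m ->
  computableb k (fun s => Ec (f s) (g s) (h s) (l s) (m s)).
Proof. by move=> Hf Hg Hh Hl Hm; apply: cp_and; [apply: cp_relc | apply: cp_maxc]. Qed.

(* Indices of the nested subformulas of [criterion], from the inside out. *)
Definition idx1 e := sync_idx e * sync_idx e.
Definition idx2 e := 2 ^ idx1 e.
Definition idx3 e := 2 ^ (2 * idx2 e).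
Definition idx4 e := 2 ^ idx3 e.
Definition idx5 e := 2 ^ idx4 e.

Lemma cf_filter_rel_idx k f : computable k f -> computable k (fun s => filter_rel_idx (f s)).
Proof. by apply: cf_op1; rewrite /filter_rel_idx; cfa. Qed.

Lemma cf_idx1 k f : computable k f -> computable k (fun s => idx1 (f s)).
Proof. by apply: cf_op1; rewrite /idx1 /sync_idx; cfa; apply: cf_filter_rel_idx; cfa. Qed.

Lemma cf_idx2 k f : computable k f -> computable k (fun s => idx2 (f s)).
Proof. by move=> Hf; apply: cf_exp; [exact: cf_const | apply: cf_idx1]. Qed.

Lemma cf_idx3 k f : computable k f -> computable k (fun s => idx3 (f s)).
Proof.
by move=> Hf; apply: cf_exp; [exact: cf_const | apply: cf_mul (cf_idx2 Hf); exact: cf_const].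
Qed.

Lemma cf_idx4 k f : computable k f -> computable k (fun s => idx4 (f s)).
Proof. by move=> Hf; apply: cf_exp; [exact: cf_const | apply: cf_idx3]. Qed.

Lemma cf_idx5 k f : computable k f -> computable k (fun s => idx5 (f s)).
Proof. by move=> Hf; apply: cf_exp; [exact: cf_const | apply: cf_idx4]. Qed.

(** Pumping ranges, here and in [boundedc], are [c ^ (j + n)]: [j] is the sum of the outer values,
    which suffices as [x < c ^ x], and [n] is the index of the formula under the quantifier, with
    [e] as bound for the states. *)
Definition nonemptyc e := bex (c ^ (2 ^ filter_rel_idx e)) (fun x =>
  bex (c ^ (x + filter_rel_idx e)) (fun y => relc (chead e) x y)).

Definition boundedc e := ball (c ^ idx5 e) (fun t => bex (c ^ (t + idx4 e)) (fun l =>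
  ball (c ^ (t + l + idx3 e)) (fun u => bex l.+1 (fun u' =>
  ball (c ^ (t + l + u + u' + idx1 e)) (fun v =>
    Ec (chead e) (chead (ctail e)) t u v == Ec (chead e) (chead (ctail e)) t u' v))))).

Definition decide e := (okc (chead (ctail e)) 0 0 0 || ~~ nonemptyc e) && boundedc e.

Lemma cp_decide : computableb 1 (fun s => decide (nth 0 s 0)).
Proof.
rewrite /decide /nonemptyc /boundedc; apply: cp_and; first apply: cp_or.
- by apply: cp_okc; cfa; apply: cf_chead; apply: cf_ctail; cfa.
- apply: cp_not; apply: (@cp_bex 1); last by cfa; apply: cf_filter_rel_idx; cfa.
  apply: (@cp_bex 2); last by cfa; apply: cf_filter_rel_idx; cfa.
  by apply: cp_relc; cfa; apply: cf_chead; cfa.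
apply: (@cp_ball 1); last by cfa; apply: cf_idx5; cfa.
apply: (@cp_bex 2); last by cfa; apply: cf_idx4; cfa.
apply: (@cp_ball 3); last by cfa; apply: cf_idx3; cfa.
apply: (@cp_bex 4); last by cfa.
apply: (@cp_ball 5); last by cfa; apply: cf_idx1; cfa.
by apply: cp_eqb; apply: cp_Ec; cfa; apply: cf_chead; cfa; apply: cf_ctail; cfa.
Qed.

(** * Correctness of the bounded searches *)

Lemma bexE_idx n P j a (B : pred nat) : idx K n P -> bounded K j a ->
  (forall x, B x <-> P (scons x a)) -> bex (c ^ (j + n)) B <-> exists x, P (scons x a).
Proof.
move=> iP ba BP; split=> [/bexP[x _ /BP h]|h]; first by exists x.
by have [x xlt /BP Bx] := idx_pump iP ba h; apply/bexP; exists x.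
Qed.

(** A counterexample is a witness of the negation, which has the same index, so it can be pumped
    down into the range. *)
Lemma ballE_idx n P j a (B : pred nat) : idx K n P -> bounded K j a ->
  (forall x, B x <-> P (scons x a)) -> ball (c ^ (j + n)) B <-> forall x, P (scons x a).
Proof.
move=> iP ba BP; split=> [/ballP h x|h]; last by apply/ballP => x _; apply/BP.
apply: contrapT => nP.
have [y /h/BP Py nPy] := idx_pump (idx_not iP) ba (ex_intro _ x nP).
exact: nPy Py.
Qed.

Lemma bounded_scons_sum j x a : bounded K j a -> bounded K (j + x) (scons x a).
Proof.
move=> ba; apply: bounded_scons.
  by apply: leq_trans (ltn_expc K x) _; rewrite leq_pexp2l // leq_addl.
by move=> i; apply: leq_trans (ba i) _; rewrite leq_pexp2l // leq_addr.
Qed.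

Lemma bounded0 : bounded K 0 (fun=> 0). Proof. by []. Qed.

Lemma decideP AS AT : finite_shiftlag ns ng (dfa_lang ns ng AS) ->
  decide (code_input AS AT) <-> criterion ns ng AS AT.
Proof.
move=> fs; set e := code_input AS AT.
have eS : chead e = code_dfa AS by apply: chead_cons.
have eT : chead (ctail e) = code_dfa AT by rewrite /e /code_input /= ctail_cons chead_cons.
have leS q a : step AS q a <= e.
  by apply: leq_trans (step_le _ _ _) _; apply: mem_leq_code_seq; rewrite mem_head.
have leT q a : step AT q a <= e.
  by apply: leq_trans (step_le _ _ _) _; apply: mem_leq_code_seq; rewrite !inE eqxx orbT.
have iE := idx_sync_rel leT leS fs.
have nl w : acc (step AS) (fun a => a < K) (fun q => q \in final AS) w ->
    ~ loop_pair (step AS) (inSigma ns) w.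
  by move=> h; apply: no_loop_pair fs _.
have iR := idx_filter_rel leS K nl.
have nonemptyP : nonemptyc e <-> exists w, dfa_lang ns ng AS w.
  pose P1 (a : env) := codes_rel ns ng AS (a 1) (a 0).
  (* The renaming [1 - i] exchanges the two components, since [y] is the inner variable. *)
  have iP1 : idx K (filter_rel_idx e) P1 by apply: (idx_sub (fun i => 1 - i) iR).
  have -> : nonemptyc e <-> exists x y, P1 (scons y (scons x (fun=> 0))).
    apply: (bexE_idx (j := 0) (idx_ex iP1) bounded0) => x.
    apply: (bexE_idx (j := 0 + x) iP1 (bounded_scons_sum _ bounded0)) => y.
    by rewrite eS; split=> /relcP.
  split=> [[x [y [w [Sw _ _]]]]|[w Sw]]; first by exists w.
  have ww : is_word ns ng w by case/andP: Sw.
  exists (enc K (filter (inSigma ns) w)), (enc K (filter (predC (inSigma ns)) w)), w.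
  by rewrite /= !encK //; exact: word_filter.
(* Variables 0 to 4 of [Q5] are [v], [u'], [u], [l] and [t]; each further formula binds the
   innermost one left. *)
pose Q5 (a : env) := sync_rel ns ng AS AT (a 4) (a 2) (a 0) <-> sync_rel ns ng AS AT (a 4) (a 1) (a 0).
pose Q4 (a : env) := forall v, Q5 (scons v a).
pose Q3 (a : env) := exists u', (u' <= a 1) /\ Q4 (scons u' a).
pose Q2 (a : env) := forall u, Q3 (scons u a).
pose Q1 (a : env) := exists l, Q2 (scons l a).
have i5 : idx K (idx1 e) Q5.
  pose f2 i := if i is 0 then 4 else if i is 1 then 2 else 0.
  pose f1 i := if i is 0 then 4 else if i is 1 then 1 else 0.
  exact: (idx_iff (idx_sub f2 iE) (idx_sub f1 iE)).
have i4 : idx K (idx2 e) Q4 by apply: idx_all.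
have i3 : idx K (idx3 e) Q3 by apply: (idx_ex (idx_and (idx_le K 0 2) i4)).
have i2 : idx K (idx4 e) Q2 by apply: idx_all.
have i1 : idx K (idx5 e) Q1 by apply: idx_ex.
have boundedP : boundedc e <-> forall t, Q1 (scons t (fun=> 0)).
  apply: (ballE_idx (j := 0) i1 bounded0) => t.
  have bt := bounded_scons_sum t bounded0; rewrite add0n in bt.
  apply: (bexE_idx i2 bt) => l; have bl := bounded_scons_sum l bt.
  apply: (ballE_idx i3 bl) => u; have bu := bounded_scons_sum u bl.
  have main u' : ball (c ^ (t + l + u + u' + idx1 e)) (fun v =>
      Ec (chead e) (chead (ctail e)) t u v == Ec (chead e) (chead (ctail e)) t u' v) <->
      Q4 (scons u' (scons u (scons l (scons t (fun=> 0))))).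
    apply: (ballE_idx i5 (bounded_scons_sum u' bu)) => v; rewrite eS eT.
    split=> [/eqP h|h]; first by split=> /EcP; rewrite /= (h, esym h) => /EcP.
    by apply/eqP; apply/idP/idP => /EcP/h/EcP.
  split=> [/bexP[u' u'l /main h]|[u' [u'l h]]]; first by exists u'.
  by apply/bexP; exists u' => //; apply/main.
have okP : okc (chead (ctail e)) 0 0 0 <-> core ns ng AT [::] by rewrite eT okc_code.
rewrite /decide /criterion; split=> [/andP[h1 /boundedP h2]|[h1 h2]].
  split; last exact: h2.
  by case/orP: h1 => [/okP|/negP h]; [left|right => /nonemptyP].
apply/andP; split; last exact/boundedP.
by apply/orP; case: h1 => [/okP|h]; [left|right; apply/negP => /nonemptyP].
Qed.

End Procedure.

Theorem mainTheorem20 (ns ng : nat) :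
  exists p : prog, forall AS AT : dfa,
    promise ns ng AS AT ->
    (in_Rel ns ng (dfa_lang ns ng AS) (dfa_lang ns ng AT) ->
       eval p [:: code_input AS AT] 1) /\
    (~ in_Rel ns ng (dfa_lang ns ng AS) (dfa_lang ns ng AT) ->
       eval p [:: code_input AS AT] 0).
Proof.
have [p Hp] := cp_decide ns ng; exists p => AS AT [fS [_ [U [_ [USG [Ucl TU]]]]]].
have decides : decide ns ng (code_input AS AT) <->
    in_Rel ns ng (dfa_lang ns ng AS) (dfa_lang ns ng AT).
  rewrite decideP //; split; last exact: criterion_of_in_Rel USG Ucl TU.
  have leS q a : step AS q a <= code_dfa AS + code_dfa AT.
    by apply: leq_trans (step_le _ _ _) (leq_addr _ _).
  have leT q a : step AT q a <= code_dfa AS + code_dfa AT.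
    by apply: leq_trans (step_le _ _ _) (leq_addl _ _).
  exact: (in_Rel_of_criterion (idx_sync_rel leT leS fS) USG TU).
have := Hp [:: code_input AS AT] erefl; rewrite [nth _ _ _]/=.
case: (decide _ _ _) decides => -[h1 h2] ev; split=> // h; first by case: h; apply: h1.
by have := h2 h.
Qed.
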